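(* Let $\kappa$ be a regular cardinal in a universe $\mathbf{U}$, let $\mathbf{U}^+$ be a universe with $\mathbf{U} \subseteq \mathbf{U}^+$, and let $i : \mathcal{C} \to \mathcal{C}^+$ be a $(\kappa,\mathbf{U},\mathbf{U}^+)$-accessible extension. (i) $\mathcal{C}$ is a locally $\kappa$-presentable $\mathbf{U}$-category if and only if $\mathcal{C}^+$ is a locally $\kappa$-presentable $\mathbf{U}^+$-category. (ii) The functor $i : \mathcal{C} \to \mathcal{C}^+$ is fully faithful. (iii) If $B : \mathcal{J} \to \mathcal{C}$ is any diagram (not necessarily $\mathbf{U}$-small) and $\mathcal{C}$ has a limit for $B$, then $i$ preserves this limit.
   Context: A pre-universe is a set $\mathbf{U}$ such that: if $x \in y$ and $y \in \mathbf{U}$ then $x \in \mathbf{U}$; if $x, y \in \mathbf{U}$ then $\{x,y\} \in \mathbf{U}$; if $x \in \mathbf{U}$ then the power set of $x$ is in $\mathbf{U}$; if $x \in \mathbf{U}$ and $f : x \to \mathbf{U}$ is a map then $\bigcup_{t \in x} f(t) \in \mathbf{U}$. A universe is a pre-universe containing $\omega$ as a member. All categories are sets (models of the theory of categories inside set theory). A category is $\mathbf{U}$-small if its sets of objects and morphisms are members of $\mathbf{U}$; it is locally $\mathbf{U}$-small if its sets of objects and morphisms are subsets of $\mathbf{U}$ and all its hom-sets are members of $\mathbf{U}$. A $\mathbf{U}$-small diagram is a functor from a $\mathbf{U}$-small category. Let $\kappa$ be a regular cardinal in a universe $\mathbf{U}$. An object $A$ of a category $\mathcal{C}$ is $(\kappa,\mathbf{U})$-compact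 if $\mathrm{Hom}_{\mathcal{C}}(A,-)$, regarded as a functor to a sufficiently large category of sets, preserves colimits of all $\mathbf{U}$-small $\kappa$-filtered diagrams; $\mathbf{K}_\kappa^{\mathbf{U}}(\mathcal{C})$ denotes the full subcategory of $(\kappa,\mathbf{U})$-compact objects. A $\kappa$-accessible $\mathbf{U}$-category is a locally $\mathbf{U}$-small category $\mathcal{C}$ that has colimits for all $\mathbf{U}$-small $\kappa$-filtered diagrams and for which there is a set $\mathcal{G} \in \mathbf{U}$ of $(\kappa,\mathbf{U})$-compact objects such that every object of $\mathcal{C}$ is a colimit of a $\mathbf{U}$-small $\kappa$-filtered diagram of objects in $\mathcal{G}$. A locally $\kappa$-presentable $\mathbf{U}$-category is a $\kappa$-accessible $\mathbf{U}$-category having colimits for all $\mathbf{U}$-small diagrams. A $(\kappa,\mathbf{U})$-accessible functor is a functor whose domain is a $\kappa$-accessible $\mathbf{U}$-category and which preserves colimits of all $\mathbf{U}$-small $\kappa$-filtered diagrams. Let $\mathbf{U}^+$ be a universe with $\mathbf{U} \subseteq \mathbf{U}^+$. A $(\kappa,\mathbf{U},\mathbf{U}^+)$-accessible extension is a $(\kappa,\mathbf{U})$-accessible functor $i : \mathcal{C} \to \mathcal{C}^+$ such that $\mathcal{C}$ is a $\kappa$-accessible $\mathbf{U}$-category, $\mathcal{C}^+$ is a $\kappa$-accessible $\mathbf{U}^+$-category, $i$ sends $(\kappa,\mathbf{U})$-compact objects of $\mathcal{C}$ to $(\kappa,\mathbf{U}^+)$-compact objects of $\mathcal{C}^+$,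 and the induced functor $\mathbf{K}_\kappa^{\mathbf{U}}(\mathcal{C}) \to \mathbf{K}_\kappa^{\mathbf{U}^+}(\mathcal{C}^+)$ is fully faithful and essentially surjective on objects. *)

(* Defs.v *)
From mathcomp Require Import ssreflect ssrfun ssrbool.
From Stdlib Require Import FunctionalExtensionality.

Set Implicit Arguments.
Unset Strict Implicit.
Unset Printing Implicit Defensive.

(* An arbitrary model of set theory.  Separation is stated for all Rocq
   predicates, so that the Rocq functions from one set to another are exactly
   the set-theoretic ones.  The axiom of choice for the model follows from
   choice in the metatheory; infinity is part of the notion of universe. *)
Record set_theory := SetTheory {
  carrier :> Type;
  elt : carrier -> carrier -> Prop;
  extensionality : forall x y, (forall z, elt z x <-> elt z y) -> x = y;
  pairing : forall x y, exists p, forall z, elt z p <-> z = x \/ z = y;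
  union : forall x, exists u, forall z,
    elt z u <-> exists y, elt z y /\ elt y x;
  powerset : forall x, exists p, forall y,
    elt y p <-> (forall z, elt z y -> elt z x);
  separation : forall (P : carrier -> Prop) x, exists y, forall z,
    elt z y <-> elt z x /\ P z
}.

Notation "x ∈ y" := (elt x y) (at level 70, no associativity).

Section Sets.
Variable S : set_theory.
Implicit Types x y z U kappa : S.

Definition El x : Type := {y : S | y ∈ x}.

Definition val x (t : El x) : S := proj1_sig t.

Definition subset x y := forall z, z ∈ x -> z ∈ y.

Definition is_pair x y p := forall z, z ∈ p <-> z = x \/ z = y.

Definition is_powerset x p := forall y, y ∈ p <-> subset y x.

Definition is_indexed_union x (f : El x -> S) u :=
  forall z, z ∈ u <-> exists t : El x, z ∈ f t.

Definition inductive_set w :=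
  (exists e, e ∈ w /\ forall z, ~ z ∈ e) /\
  (forall x, x ∈ w -> exists s, s ∈ w /\ forall z, z ∈ s <-> z ∈ x \/ z = x).

Definition is_omega w :=
  inductive_set w /\ forall v, inductive_set v -> subset w v.

Definition pre_universe U :=
  [/\ forall x y, x ∈ y -> y ∈ U -> x ∈ U,
      forall x y, x ∈ U -> y ∈ U -> exists p, is_pair x y p /\ p ∈ U,
      forall x, x ∈ U -> exists p, is_powerset x p /\ p ∈ U &
      forall x (f : El x -> El U), x ∈ U ->
        exists u, is_indexed_union (fun t => val (f t)) u /\ u ∈ U].

Definition universe U :=
  pre_universe U /\ exists w, is_omega w /\ w ∈ U.

Definition transitive_set x := forall y, y ∈ x -> subset y x.

(* A transitive set strictly well-ordered by membership; transitivity of the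
   order is the transitivity of the members. Foundation is not assumed. *)
Definition ordinal x :=
  [/\ transitive_set x,
      forall y, y ∈ x -> transitive_set y,
      forall y, y ∈ x -> ~ y ∈ y &
      forall P : S -> Prop, (exists y, y ∈ x /\ P y) ->
        exists y, [/\ y ∈ x, P y &
          forall z, z ∈ x -> P z -> y = z \/ y ∈ z]].

Definition equipotent x y := exists f : El x -> El y, bijective f.

Definition cardinal kappa :=
  ordinal kappa /\ forall a, a ∈ kappa -> ~ equipotent a kappa.

(* Infinite, and no function from a smaller ordinal is cofinal. *)
Definition regular_cardinal kappa :=
  [/\ cardinal kappa,
      exists w, is_omega w /\ subset w kappa &
      forall a (f : El a -> El kappa), a ∈ kappa ->
        exists b, b ∈ kappa /\ forall t, val (f t) ∈ b].

(* The cardinality of x is less than the cardinal kappa. *)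
Definition card_lt x kappa := exists a, a ∈ kappa /\ equipotent x a.

End Sets.

Record category := Category {
  obj :> Type;
  hom : obj -> obj -> Type;
  idm : forall A, hom A A;
  comp : forall A B C, hom B C -> hom A B -> hom A C;
  comp_idl : forall A B (f : hom A B), comp (idm B) f = f;
  comp_idr : forall A B (f : hom A B), comp f (idm A) = f;
  comp_assoc : forall A B C D (h : hom C D) (g : hom B C) (f : hom A B),
    comp h (comp g f) = comp (comp h g) f
}.

Record functor (C D : category) := Functor {
  fobj :> C -> D;
  fmor : forall A B, hom A B -> hom (fobj A) (fobj B);
  fmor_id : forall A, fmor (idm A) = idm (fobj A);
  fmor_comp : forall A B E (g : hom B E) (f : hom A B),
    fmor (comp g f) = comp (fmor g) (fmor f)
}.

Lemma comp_functor_id (C D E : category) (G : functor D E) (F : functor C D)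
  (A : C) : fmor G (fmor F (idm A)) = idm (G (F A)).
Proof. by rewrite !fmor_id. Qed.

Lemma comp_functor_comp (C D E : category) (G : functor D E) (F : functor C D)
  (A B B' : C) (g : hom B B') (f : hom A B) :
  fmor G (fmor F (comp g f)) = comp (fmor G (fmor F g)) (fmor G (fmor F f)).
Proof. by rewrite !fmor_comp. Qed.

Definition comp_functor (C D E : category) (G : functor D E)
  (F : functor C D) : functor C E :=
  @Functor C E (fun A => G (F A)) (fun A B f => fmor G (fmor F f))
    (comp_functor_id G F) (comp_functor_comp G F).

Definition isomorphic (C : category) (A B : C) :=
  exists (f : hom A B) (g : hom B A), comp g f = idm A /\ comp f g = idm B.

Definition fully_faithful (C D : category) (F : functor C D) :=
  forall A B : C, bijective (@fmor C D F A B).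

Definition essentially_surjective (C D : category) (F : functor C D) :=
  forall B : D, exists A : C, isomorphic (F A) B.

Record cocone (J C : category) (D : functor J C) := Cocone {
  apex : C;
  leg : forall j, hom (D j) apex;
  leg_nat : forall j k (u : hom j k), comp (leg k) (fmor D u) = leg j
}.

Definition is_colimit (J C : category) (D : functor J C) (c : cocone D) :=
  forall c' : cocone D, exists! u : hom (apex c) (apex c'),
    forall j, comp u (leg c j) = leg c' j.

Lemma map_cocone_nat (J C E : category) (D : functor J C) (F : functor C E)
  (c : cocone D) (j k : J) (u : hom j k) :
  comp (fmor F (leg c k)) (fmor (comp_functor F D) u) = fmor F (leg c j).
Proof. by rewrite /= -fmor_comp leg_nat. Qed.

Definition map_cocone (J C E : category) (D : functor J C) (F : functor C E)
  (c : cocone D) : cocone (comp_functor F D) :=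
  @Cocone J E (comp_functor F D) (F (apex c)) (fun j => fmor F (leg c j))
    (map_cocone_nat F c).

Definition has_colimit (J C : category) (D : functor J C) :=
  exists c : cocone D, is_colimit c.

Definition preserves_colimit (J C E : category) (F : functor C E)
  (D : functor J C) :=
  forall c : cocone D, is_colimit c -> is_colimit (map_cocone F c).

Record cone (J C : category) (D : functor J C) := Cone {
  vertex : C;
  proj : forall j, hom vertex (D j);
  proj_nat : forall j k (u : hom j k), comp (fmor D u) (proj j) = proj k
}.

Definition is_limit (J C : category) (D : functor J C) (c : cone D) :=
  forall c' : cone D, exists! u : hom (vertex c') (vertex c),
    forall j, comp (proj c j) u = proj c' j.

Lemma map_cone_nat (J C E : category) (D : functor J C) (F : functor C E)
  (c : cone D) (j k : J) (u : hom j k) :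
  comp (fmor (comp_functor F D) u) (fmor F (proj c j)) = fmor F (proj c k).
Proof. by rewrite /= -fmor_comp proj_nat. Qed.

Definition map_cone (J C E : category) (D : functor J C) (F : functor C E)
  (c : cone D) : cone (comp_functor F D) :=
  @Cone J E (comp_functor F D) (F (vertex c)) (fun j => fmor F (proj c j))
    (map_cone_nat F c).

Definition preserves_limit (J C E : category) (F : functor C E)
  (D : functor J C) :=
  forall c : cone D, is_limit c -> is_limit (map_cone F c).

Definition full_subcategory (C : category) (P : C -> Prop) : category :=
  @Category {A : C | P A}
    (fun A B => hom (proj1_sig A) (proj1_sig B))
    (fun A => idm (proj1_sig A))
    (fun A B E g f => comp g f)
    (fun A B f => comp_idl f)
    (fun A B f => comp_idr f)
    (fun A B E E' h g f => comp_assoc h g f).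

Definition restrict_functor (C D : category) (F : functor C D)
  (P : C -> Prop) (Q : D -> Prop) (PQ : forall A, P A -> Q (F A)) :
  functor (full_subcategory P) (full_subcategory Q) :=
  @Functor (full_subcategory P) (full_subcategory Q)
    (fun A => exist Q (F (proj1_sig A)) (PQ _ (proj2_sig A)))
    (fun A B f => fmor F f)
    (fun A => fmor_id F (proj1_sig A))
    (fun A B E g f => fmor_comp F g f).

(* A category in the model: a set of objects and a set of morphisms, the latter
   being the disjoint union of the hom-sets; [hom_disjoint] makes the domain and
   codomain of a morphism well defined. *)
Record set_category (S : set_theory) := SetCategory {
  ob : S;
  mor : S;
  homset : El ob -> El ob -> S;
  mor_homset : forall f, f ∈ mor <-> exists A B, f ∈ homset A B;
  hom_disjoint : forall f A B A' B',
    f ∈ homset A B -> f ∈ homset A' B' -> A = A' /\ B = B';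
  set_id : forall A, El (homset A A);
  set_comp : forall A B C,
    El (homset B C) -> El (homset A B) -> El (homset A C);
  set_comp_idl : forall A B (f : El (homset A B)), set_comp (set_id B) f = f;
  set_comp_idr : forall A B (f : El (homset A B)), set_comp f (set_id A) = f;
  set_comp_assoc : forall A B C D (h : El (homset C D)) (g : El (homset B C))
    (f : El (homset A B)),
    set_comp h (set_comp g f) = set_comp (set_comp h g) f
}.

Definition category_of (S : set_theory) (C : set_category S) : category :=
  @Category (El (ob C)) (fun A B => El (homset A B)) (@set_id S C)
    (@set_comp S C) (@set_comp_idl S C) (@set_comp_idr S C)
    (@set_comp_assoc S C).

Coercion category_of : set_category >-> category.

(* All sets of the model and all maps between them. *)
Definition SET (S : set_theory) : category :=
  @Category S (fun x y => El x -> El y) (fun x t => t)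
    (fun x y z g f t => g (f t))
    (fun x y f => erefl f) (fun x y f => erefl f)
    (fun x y z w h g f => erefl (fun t => h (g (f t)))).

Section HomFunctor.
Variables (S : set_theory) (C : set_category S) (A : C).

Definition hom_mor (B B' : C) (g : hom B B') :
  @hom (SET S) (homset A B) (homset A B') :=
  fun f : hom A B => comp g f.

Lemma hom_mor_id (B : C) : hom_mor (idm B) = @idm (SET S) (homset A B).
Proof. apply: functional_extensionality => f; exact: (@comp_idl C). Qed.

Lemma hom_mor_comp (B B' B'' : C) (g : hom B' B'') (f : hom B B') :
  hom_mor (comp g f) = @comp (SET S) _ _ _ (hom_mor g) (hom_mor f).
Proof.
by apply: functional_extensionality => h; rewrite /= /hom_mor -(@comp_assoc C).
Qed.

Definition hom_functor : functor C (SET S) :=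
  @Functor C (SET S) (fun B => homset A B) hom_mor hom_mor_id hom_mor_comp.

End HomFunctor.

Section Accessible.
Variables (S : set_theory) (kappa U : S).

Definition small (C : set_category S) := ob C ∈ U /\ mor C ∈ U.

Definition locally_small (C : set_category S) :=
  [/\ subset (ob C) U, subset (mor C) U & forall A B : C, homset A B ∈ U].

(* Every diagram in J with fewer than kappa morphisms has a cocone. *)
Definition filtered (J : set_category S) :=
  forall (D : set_category S) (F : functor D J),
    card_lt (mor D) kappa -> inhabited (cocone F).

Definition has_filtered_colimits (C : category) :=
  forall (J : set_category S) (D : functor J C),
    small J -> filtered J -> has_colimit D.

Definition preserves_filtered_colimits (C E : category) (F : functor C E) :=
  forall (J : set_category S) (D : functor J C),
    small J -> filtered J -> preserves_colimit F D.

Definition compact (C : set_category S) (A : C) :=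
  preserves_filtered_colimits (hom_functor A).

Definition accessible_category (C : set_category S) :=
  [/\ locally_small C,
      has_filtered_colimits C &
      exists G : S,
        [/\ G ∈ U,
            forall x, x ∈ G -> exists A : C, val A = x /\ compact A &
            forall A : C, exists (J : set_category S) (D : functor J C)
              (c : cocone D),
              [/\ small J, filtered J, forall j, val (D j) ∈ G,
                  is_colimit c & apex c = A]]].

Definition locally_presentable_category (C : set_category S) :=
  accessible_category C /\
  forall (J : set_category S) (D : functor J C), small J -> has_colimit D.

Definition accessible_functor (C : set_category S) (E : category)
  (F : functor C E) :=
  accessible_category C /\ preserves_filtered_colimits F.

Definition compact_subcategory (C : set_category S) : category :=
  full_subcategory (@compact C).

End Accessible.

Definition accessible_extension (S : set_theory) (kappa U Uplus : S)
  (C Cplus : set_category S) (i : functor C Cplus) :=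
  [/\ accessible_functor kappa U i,
      accessible_category kappa U C,
      accessible_category kappa Uplus Cplus &
      exists ic : forall A : C,
          compact kappa U A -> compact kappa Uplus (i A),
        let iK : functor (compact_subcategory kappa U C)
                         (compact_subcategory kappa Uplus Cplus) :=
          restrict_functor ic in
        fully_faithful iK /\ essentially_surjective iK].

(* Main.v *)
(** The object [A] is compact exactly when, for every small filtered colimit [c]
    of a diagram [D], each arrow from [A] to [apex c] factors through some [D j],
    and two arrows from [A] to [D j] with the same image in [apex c] already agree
    at a later stage.

    For (ii), an arrow from [i A] to [i B] with [A] compact and [B] a filtered
    colimit of compact objects comes from a stage of that colimit, where [i] is
    bijective on arrows; a general [A] is a colimit of compact objects, and [i]
    preserves it.  For (iii), the universal property of the image of a limit cone
    need only be tested on the objects [i A] with [A] compact, and by (ii) it holds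
    there.

    For (i), an accessible category is cocomplete as soon as its diagrams of fewer
    than [kappa] compact objects have colimits.  Indeed, every object is the colimit
    of the generators over it, so a small colimit can be rewritten as the colimit of
    a small diagram of generators, and this is the [kappa]-directed colimit of the
    colimits of its subdiagrams of size less than [kappa].  Such a colimit of compact
    objects is again compact; it is reflected by [i] since [i] is fully faithful, and
    preserved by [i] because a cocone of compact objects over a filtered colimit
    factors through one of its stages. *)

From mathcomp Require Import ssreflect ssrfun ssrbool.
From Stdlib Require Import Classical ClassicalEpsilon FunctionalExtensionality.
From Stdlib Require Import PropExtensionality ProofIrrelevance.
Require Import Defs.

Set Implicit Arguments.
Unset Strict Implicit.
Unset Printing Implicit Defensive.

Arguments category_of : simpl never.

(** * Choice, and injectivity of projections *)

Lemma choice_fun (I : Type) (T : I -> Type) (P : forall i, T i -> Prop) :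
  (forall i, exists t, P i t) -> exists f : forall i, T i, forall i, P i (f i).
Proof.
move=> ex; exists (fun i => proj1_sig (constructive_indefinite_description _ (ex i))).
by move=> i; case: constructive_indefinite_description.
Qed.

Lemma inj_surj_bij (X Y : Type) (f : X -> Y) :
  injective f -> (forall y, exists x, f x = y) -> bijective f.
Proof.
move=> f_inj /choice_fun[g fg]; exists g => // x.
by apply: f_inj; rewrite fg.
Qed.

Lemma sig_val_inj (T : Type) (P : T -> Prop) : injective (@proj1_sig T P).
Proof.
by move=> [x px] [y py] /= exy; subst y; rewrite (proof_irrelevance _ px py).
Qed.

Lemma El_inj (S : set_theory) (x : S) : injective (@val S x).
Proof. exact: sig_val_inj. Qed.

Definition to_El (S : set_theory) (x y : S) (yx : y ∈ x) : El x := exist _ y yx.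

(** * Size classes of types *)

(** The closure properties common to [ksmall] and [usmall], isolated so that sums, products, options
    and images are treated once for both. *)
Record size_class (P : Type -> Prop) : Prop := SizeClass {
  size_inj : forall (T T' : Type) (f : T -> T'), injective f -> P T' -> P T;
  size_bool : P bool;
  size_sigma : forall (T : Type) (F : T -> Type),
    P T -> (forall t, P (F t)) -> P {t : T & F t}
}.

Section SizeClass.
Variables (P : Type -> Prop) (Psize : size_class P).

Lemma size_sum (T T' : Type) : P T -> P T' -> P (T + T')%type.
Proof.
move=> PT PT'.
pose F (b : bool) := if b then T else T'.
have PF : P {b : bool & F b} by apply: (size_sigma Psize (size_bool Psize)) => -[].
pose f (t : T + T') : {b : bool & F b} :=
  match t with inl t => existT F true t | inr t => existT F false t end.
apply: (size_inj Psize (f := f)) PF => -[x|x] [y|y] //= e.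
- by rewrite (inj_pair2 _ _ _ _ _ e).
- by rewrite (inj_pair2 _ _ _ _ _ e).
Qed.

Lemma size_prod (T T' : Type) : P T -> P T' -> P (T * T')%type.
Proof.
move=> PT PT'.
pose f (t : T * T') : {_ : T & T'} := existT (fun=> T') t.1 t.2.
apply: (size_inj Psize (f := f)); last exact: (size_sigma Psize).
by move=> [x x'] [y y'] [-> /= ->].
Qed.

Lemma size_unit : P unit.
Proof.
by apply: (size_inj Psize (f := fun=> true)) (size_bool Psize) => -[] [].
Qed.

Lemma size_option (T : Type) : P T -> P (option T).
Proof.
move=> PT; pose f (t : option T) := if t is Some t then inl t else inr tt.
apply: (size_inj Psize (f := f)) (size_sum PT size_unit).
by move=> [x|] [y|] //= [->].
Qed.

Lemma size_void : P void.
Proof. by apply: (size_inj Psize (f := fun=> true)) (size_bool Psize) => -[]. Qed.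

Lemma size_sub (T : Type) (Q : T -> Prop) : P T -> P {t : T | Q t}.
Proof. exact: (size_inj Psize (@sig_val_inj T Q)). Qed.

Lemma size_image (I T : Type) (g : I -> T) : P I -> P {t : T | exists i, g i = t}.
Proof.
move=> PI; have [f fP] := choice_fun (fun t : {t | exists i, g i = t} => proj2_sig t).
by apply: (size_inj Psize (f := f)) PI => s t e; apply: sig_val_inj; rewrite -!fP e.
Qed.

End SizeClass.

(** * Sizes below a regular cardinal *)

Section RegularCardinal.
Variables (S : set_theory) (kappa : S).
Hypothesis kappa_regular : regular_cardinal kappa.

(* Equivalent to equipotence with a member of [kappa], see [ksmall_card]; stated
   in this way, it passes to subtypes for free. *)
Definition ksmall (T : Type) := ~ exists f : El kappa -> T, injective f.

Let kappa_ord : ordinal kappa.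
Proof. by case: kappa_regular => -[]. Qed.

Let lt (a b : El kappa) := val a ∈ val b.

Lemma kappa_irrefl (a : El kappa) : ~ lt a a.
Proof. by case: kappa_ord => _ _ h _; apply: h; apply: (proj2_sig a). Qed.

Lemma kappa_trans (a b c : El kappa) : lt a b -> lt b c -> lt a c.
Proof.
by move=> ab bc; case: kappa_ord => _ h _ _; exact: (h _ (proj2_sig c) _ bc _ ab).
Qed.

Lemma kappa_least (P : El kappa -> Prop) : (exists a, P a) ->
  exists2 a, P a & forall b, P b -> a = b \/ lt a b.
Proof.
move=> [[a ka] Pa]; case: kappa_ord => _ _ _ least.
have [|b [kb [kb' Pb] bmin]] := least (fun x => exists kx, P (exist _ x kx)).
  by exists a; split=> //; exists ka.
exists (exist _ b kb) => [|[c kc] Pc].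
  by rewrite (proof_irrelevance _ kb kb').
have [|e|] := bmin c kc; [by exists kc| |by right].
by left; apply: El_inj.
Qed.

Lemma kappa_total (a b : El kappa) : [\/ a = b, lt a b | lt b a].
Proof.
have [|c] := @kappa_least (fun c => c = a \/ c = b); first by exists a; left.
move=> [-> /(_ b (or_intror erefl))|-> /(_ a (or_introl erefl))] [];
  by [constructor 1|constructor 2|constructor 3].
Qed.

Lemma kappa_wf : well_founded lt.
Proof.
move=> a; apply: NNPP => na.
have [|b nb bmin] := @kappa_least (fun a => ~ Acc lt a); first by exists a.
apply: nb; constructor=> c cb; apply: NNPP => nc.
have [e|bc] := bmin c nc; first by apply: (@kappa_irrefl b); rewrite {1}e.
exact: (@kappa_irrefl b) (kappa_trans bc cb).
Qed.

Lemma El_lt (a : El kappa) (x : El (val a)) : val x ∈ kappa.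
Proof. case: kappa_ord => h _ _ _; exact: (h _ (proj2_sig a) _ (proj2_sig x)). Qed.

(* Enumerate [T] along [kappa] without repetition for as long as possible: the
   process exhausts [T] at some stage below [kappa], or injects [kappa]. *)
Lemma ksmall_card (T : Type) : ksmall T ->
  exists (a : El kappa) (f : El (val a) -> T), bijective f.
Proof.
move=> sT.
pose fresh a (g : forall b, lt b a -> option T) t := forall b ba, g b ba <> Some t.
(* [None] marks a stage at which all of [T] has already been enumerated. *)
pose step a (g : forall b, lt b a -> option T) : option T :=
  match excluded_middle_informative (exists t, fresh a g t) with
  | left p => Some (proj1_sig (constructive_indefinite_description _ p))
  | right _ => None
  end.
pose g := Fix kappa_wf (fun=> option T) step.
have gE a : g a = step a (fun b _ => g b).
  rewrite /g Fix_eq // => b h h' hh'; congr step.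
  by apply: functional_extensionality_dep => c; apply: functional_extensionality.
have gSome a t : g a = Some t -> forall b, lt b a -> g b <> Some t.
  rewrite gE /step; case: excluded_middle_informative => // p [<-].
  by case: constructive_indefinite_description.
have gNone a : g a = None -> forall t, exists2 b, lt b a & g b = Some t.
  rewrite gE /step; case: excluded_middle_informative => // p _ t.
  apply: NNPP => q; apply: p; exists t => b ba gb; apply: q; by exists b.
have g_inj a b t : g a = Some t -> g b = Some t -> a = b.
  by move=> ga gb; case: (kappa_total a b) => // /gSome; [case/(_ t gb)|case/(_ t ga)].
have [ex|nex] := classic (exists a, g a = None); last first.
  case: sT; have [|f fP] := @choice_fun (El kappa) (fun=> T) (fun a t => g a = Some t).
    by move=> a; case ga: (g a) => [t|]; [exists t|case: nex; exists a].
  by exists f => a b fab; apply: (g_inj a b (f a)); rewrite fP ?fab.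
have [a ga amin] := kappa_least ex.
pose emb (x : El (val a)) : El kappa := exist _ (val x) (El_lt x).
have [|f fP] := @choice_fun (El (val a)) (fun=> T) (fun x t => g (emb x) = Some t).
  move=> x; case gx: (g (emb x)) => [t|]; first by exists t.
  have xa : lt (emb x) a by apply: (proj2_sig x).
  have [e|ax] := amin _ gx; case: (@kappa_irrefl a); first by rewrite {1}e.
  exact: kappa_trans ax xa.
exists a, f; apply: inj_surj_bij => [x y fxy|t].
  by apply: El_inj; have [] : emb x = emb y by apply: (g_inj _ _ (f x)); rewrite fP ?fxy.
have [b ba gb] := gNone a ga t; exists (exist _ (val b) ba).
apply/esym; have := fP (exist _ (val b) ba).
have -> : emb (exist _ (val b) ba) = b by apply: El_inj.
by rewrite gb => -[].
Qed.

(** Regularity speaks of functions on a member of [kappa]; the enumeration of [I] by such a member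
    reduces to that case. *)
Lemma ksmall_bounded (I : Type) (f : I -> El kappa) : ksmall I ->
  exists b : El kappa, forall i, lt (f i) b.
Proof.
move=> /ksmall_card[a [g [g' gK g'K]]]; case: kappa_regular => _ _ reg.
have [b [kb fb]] := reg _ (fun x => f (g x)) (proj2_sig a).
by exists (exist _ b kb) => i; rewrite -(g'K i); apply: fb.
Qed.

(** An injection of [kappa] into [x] gives one into some [a] in [kappa], hence a surjection [g] of
    [a] onto [kappa]. Regularity bounds [g] strictly by some [b], and [b] is itself a value of
    [g]. *)
Lemma card_lt_ksmall (x : S) : card_lt x kappa -> ksmall (El x).
Proof.
move=> [a [ka [f [f' fK _]]]] [h h_inj]; case: kappa_regular => _ _ reg.
have [g gP] : exists g : El a -> El kappa,
    forall b, exists t, g t = b.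
  have [|g gP] := @choice_fun (El a) (fun=> El kappa)
    (fun t b => (exists c, f (h c) = t) -> f (h b) = t).
    move=> t; have [[c]|n] := classic (exists c, f (h c) = t); first by exists c.
    (* Default value outside the image of the injection. *)
    by exists (exist _ a ka) => /n.
  exists g => b; exists (f (h b)); apply: h_inj; apply: (can_inj fK).
  by apply: gP; exists b.
have [b [kb gb]] := reg a g ka.
have [t gt] := gP (exist _ b kb); have := gb t; rewrite gt.
exact: kappa_irrefl.
Qed.

Lemma ksmall_card_lt (x : S) : ksmall (El x) -> card_lt x kappa.
Proof.
move=> /ksmall_card[[a ka] [f [g fK gK]]]; exists a; split=> //.
by exists g; exists f.
Qed.

Lemma ksmall_size : size_class ksmall.
Proof.
split.
- by move=> T T' f f_inj sT [h h_inj]; apply: sT; exists (f \o h); apply: inj_comp.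
(* [kappa] contains the three distinct sets 0, 1, 2 ([e], [s], [s']), which cannot inject into
   [bool]. *)
- move=> [h h_inj]; case: kappa_regular => _ [w [[[[e [we eP]] suc] _] wk]] _.
  have [s [ws sP]] := suc e we; have [s' [ws' s'P]] := suc s ws.
  pose h' x (wx : x ∈ w) := h (exist _ x (wk x wx)).
  have h'_inj x y (wx : x ∈ w) (wy : y ∈ w) : h' x wx = h' y wy -> x = y.
    by move=> /h_inj[].
  have es : e <> s by move=> ees; apply: (eP e); rewrite {2}ees sP; right.
  have es' : e <> s' by move=> ees; apply: (eP s); rewrite {1}ees s'P; right.
  have ss' : s <> s'.
    move=> sss; have : s ∈ s by rewrite {2}sss s'P; right.
    by rewrite sP => -[/eP|/esym].
  case a: (h' e we); case b: (h' s ws); case c: (h' s' ws');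
    try by [case: es; apply: h'_inj; rewrite a b
           |case: es'; apply: h'_inj; rewrite a c
           |case: ss'; apply: h'_inj; rewrite b c].
- move=> T F sT sF [h h_inj].
  (* Regularity is used twice. The indices that [h] sends into the summand over [i] are bounded by
     [beta i], and all [beta i] by one [b]; then [b] lies below the bound of its own summand, hence
     below itself. *)
  have [|beta betaP] := @choice_fun T (fun=> El kappa)
    (fun i b => forall a, projT1 (h a) = i -> lt a b).
    move=> i; have [kap|nk] := classic (inhabited (El kappa)); last first.
      case: nk; case: kappa_regular => _ [w [[[[e [we eP]] suc] _] wk]] _.
      by split; exists e; apply: wk.
    have [|f fP] := @choice_fun (F i) (fun=> El kappa)
      (fun t b => (exists c, h c = existT F i t) -> h b = existT F i t).
      move=> t; have [[c]|n] := classic (exists c, h c = existT F i t).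
        by exists c.
      by case: kap => b; exists b => /n.
    have [b bP] := ksmall_bounded f (sF i); exists b => a.
    case ha: (h a) => [j t] /= ij; subst j.
    have -> : a = f t; last exact: bP.
    by apply: h_inj; rewrite fP //; exists a.
  have [b bP] := ksmall_bounded beta sT.
  have := betaP _ b erefl => /kappa_trans /(_ (bP _)); exact: kappa_irrefl.
Qed.

End RegularCardinal.

(** * Sizes in a universe *)

Section Universes.
Variables (S : set_theory) (U : S).
Hypothesis U_universe : universe U.

Definition usmall (T : Type) :=
  exists2 x : S, x ∈ U & exists2 f : T -> S, injective f & forall t, f t ∈ x.

Definition upair (x y : S) : S :=
  proj1_sig (constructive_indefinite_description _ (pairing x y)).

Lemma upairP (x y z : S) : z ∈ upair x y <-> z = x \/ z = y.
Proof. exact: (proj2_sig (constructive_indefinite_description _ (pairing x y))). Qed.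

Lemma upair_inj (x y y' : S) : upair x y = upair x y' -> y = y'.
Proof.
move=> e.
have : y ∈ upair x y' by rewrite -e upairP; right.
have : y' ∈ upair x y by rewrite e upairP; right.
by rewrite !upairP => -[->|->] // [->|->].
Qed.

(** The Kuratowski pair. *)
Definition opair (x y : S) : S := upair (upair x x) (upair x y).

Lemma opair_inj (x y x' y' : S) : opair x y = opair x' y' -> x = x' /\ y = y'.
Proof.
move=> e; have xx : x = x'.
  have : upair x x ∈ opair x' y' by rewrite -e upairP; left.
  have x'in z : x' ∈ upair x' z by rewrite upairP; left.
  rewrite upairP => -[h|h]; have := x'in x'; have := x'in y';
    [move=> _|move=> + _]; rewrite -h upairP; by case.
by subst x'; split=> //; move/upair_inj/upair_inj: e.
Qed.

Let U_trans (x y : S) : x ∈ y -> y ∈ U -> x ∈ U.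
Proof. by case: U_universe => -[h _ _ _] _; apply: h. Qed.

Lemma universe_power (x : S) : x ∈ U ->
  exists2 p, p ∈ U & forall y, subset y x -> y ∈ p.
Proof.
case: U_universe => -[_ _ h _] _ /h[p [pP pU]].
by exists p => // y; apply (pP y).
Qed.

Lemma universe_subset (x y : S) : x ∈ U -> subset y x -> y ∈ U.
Proof. by move=> /universe_power[p pU pP] /pP yp; apply: U_trans pU. Qed.

Lemma universe_family (x : S) (f : El x -> El U) : x ∈ U ->
  exists2 u, u ∈ U & forall t, subset (val (f t)) u.
Proof.
case: U_universe => -[_ _ _ h] _ xU.
have [u [uP uU]] := h x f xU.
by exists u => // t z zt; apply/uP; exists t.
Qed.

Lemma universe_cup (x y : S) : x ∈ U -> y ∈ U ->
  exists2 u, u ∈ U & subset x u /\ subset y u.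
Proof.
move=> xU yU; case: U_universe => -[_ h _ _] _.
have [p [pP pU]] := h x y xU yU.
pose f (t : El p) : El U := exist _ (val t) (U_trans (proj2_sig t) pU).
have [u uU uP] := universe_family f pU.
have xp : x ∈ p by apply/pP; left.
have yp : y ∈ p by apply/pP; right.
by exists u => //; split; [apply: (uP (exist _ x xp))|apply: (uP (exist _ y yp))].
Qed.

Lemma El_usmall (x : S) : x ∈ U -> usmall (El x).
Proof.
move=> xU; exists x => //; exists (@val S x); first exact: El_inj.
exact: proj2_sig.
Qed.

Lemma usmall_size : size_class usmall.
Proof.
split.
- move=> T T' f f_inj [x xU [g g_inj gx]].
  by exists x => //; exists (g \o f) => [|t]; [apply: inj_comp|apply: gx].
- case: U_universe => _ [w [[[[e [we eP]] suc] _] wU]].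
  have [s [ws sP]] := suc e we.
  exists w => //; exists (fun b : bool => if b then e else s); last by case.
  have es : e <> s by move=> ees; apply: (eP e); rewrite {2}ees sP; right.
  by move=> [] [] // /esym.
- move=> T F [x xU [f f_inj fx]] sF.
  have [|X XP] := choice_fun (T := fun=> S) (P := fun t X => X ∈ U /\
      exists2 g : F t -> S, injective g & forall w, g w ∈ X).
    by move=> t; have [X XU h] := sF t; exists X.
  have [|h hP] := choice_fun (T := fun t => F t -> S)
      (P := fun t g => injective g /\ forall w, g w ∈ X t).
    by move=> t; have [_ [g g_inj gX]] := XP t; exists g.
  (* Families in a universe are indexed by the elements of a set, so [X] is extended from the codes
     of [T] to all of [x], with default value [x]. *)
  have [|Y YP] := choice_fun (I := El x) (T := fun=> El U)
      (P := fun y Y => forall t, f t = val y -> val Y = X t).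
    move=> y; have [[t ft]|n] := classic (exists t, f t = val y).
      have [XU _] := XP t; exists (exist _ (X t) XU) => t' ft'.
      by congr X; apply: f_inj; rewrite ft.
    by exists (exist _ x xU) => t ft; case: n; exists t.
  have [u uU uP] := universe_family Y xU.
  (* All codes lie in [z], so their Kuratowski pairs lie in the double power set [q] of [z]. *)
  have [z zU [xz uz]] := universe_cup xU uU.
  have [p pU pP] := universe_power zU.
  have [q qU qP] := universe_power pU.
  exists q => //; exists (fun t => opair (f (projT1 t)) (h _ (projT2 t))).
    move=> [t w] [t' w'] /= /opair_inj[/f_inj ett]; subst t'.
    by have [h_inj _] := hP t; move/h_inj=> ->.
  move=> [t w] /=; have fz : f t ∈ z by apply/xz/fx.
  have hz : h t w ∈ z.
    apply/uz/(uP (exist _ (f t) (fx t))); rewrite (YP (exist _ (f t) (fx t)) t erefl).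
    by have [_] := hP t; apply.
  by apply: qP => a /upairP[] ->; apply: pP => b /upairP[] ->.
Qed.

(** A predicate is coded by the subset of [x] formed by the codes of the elements satisfying it.
    This will bound the number of subgraphs of a small graph. *)
Lemma usmall_pred (T : Type) : usmall T -> usmall (T -> Prop).
Proof.
move=> [x xU [f f_inj fx]]; have [p pU pP] := universe_power xU.
have [|c cP] := choice_fun (I := T -> Prop) (T := fun=> S)
  (P := fun P y => forall z, z ∈ y <-> z ∈ x /\ exists2 t, f t = z & P t).
  by move=> P; apply: separation.
exists p => //; exists c => [P Q e|P]; last by apply: pP => z /cP[].
apply: functional_extensionality => t; apply: propositional_extensionality.
have key R : R t <-> f t ∈ c R.
  split=> [Rt|]; first by apply/cP; split=> //; exists t.
  by move=> /cP[_ [t' /f_inj ->]].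
by rewrite !key e.
Qed.

End Universes.

Lemma ksmall_usmall (S : set_theory) (kappa U : S) (T : Type) :
  regular_cardinal kappa -> universe U -> kappa ∈ U ->
  ksmall kappa T -> usmall U T.
Proof.
move=> kr Uu kU sT.
have [a [f [g fK gK]]] := ksmall_card kr sT.
apply: (size_inj (usmall_size Uu) (can_inj gK)).
apply: El_usmall; case: Uu => -[tr _ _ _] _.
exact: (tr _ kappa (proj2_sig a) kU).
Qed.

(** * Colimits and equivalences of categories *)

Section Colimits.
Variables (J C : category) (D : functor J C) (c : cocone D).
Hypothesis c_colim : is_colimit c.

Lemma colimit_exists (Y : C) (m : forall j, hom (D j) Y) :
  (forall j k (u : hom j k), comp (m k) (fmor D u) = m j) ->
  exists u : hom (apex c) Y, forall j, comp u (leg c j) = m j.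
Proof. by move=> mn; have [u [um _]] := c_colim (Cocone mn); exists u. Qed.

Lemma colimit_unique (Y : C) (u v : hom (apex c) Y) :
  (forall j, comp u (leg c j) = comp v (leg c j)) -> u = v.
Proof.
move=> uv; have mn j k (w : hom j k) :
  comp (comp v (leg c k)) (fmor D w) = comp v (leg c j).
  by rewrite -comp_assoc leg_nat.
have [w [_ w_uniq]] := c_colim (Cocone mn).
by rewrite -(w_uniq u) // -(w_uniq v).
Qed.

End Colimits.

Lemma colimit_intro (J C : category) (D : functor J C) (c : cocone D) :
  (forall Y (m : forall j, hom (D j) Y),
     (forall j k (u : hom j k), comp (m k) (fmor D u) = m j) ->
     exists u : hom (apex c) Y, forall j, comp u (leg c j) = m j) ->
  (forall Y (u v : hom (apex c) Y),
     (forall j, comp u (leg c j) = comp v (leg c j)) -> u = v) ->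
  is_colimit c.
Proof.
move=> ex uniq [Y m mn]; have [u um] := ex Y m mn.
by exists u; split=> // v vm; apply: uniq => j; rewrite um vm.
Qed.

(** * Transport of cocones and colimits along a weak equivalence of index categories *)

Section WeakEquivalence.
Variables (X' X : category) (F : functor X' X).
Hypotheses (F_ff : fully_faithful F) (F_es : essentially_surjective F).

Lemma full_lift (A B : X') (h : hom (F A) (F B)) : exists h', fmor F h' = h.
Proof. by have [g _ gK] := F_ff A B; exists (g h). Qed.

Lemma faithful_inj (A B : X') : injective (@fmor _ _ F A B).
Proof. exact: bij_inj. Qed.

Lemma cocone_lift (I : category) (D : functor I X') :
  inhabited (cocone (comp_functor F D)) -> inhabited (cocone D).
Proof.
move=> [[Y l ln]]; have [B [_ [g [_ _]]]] := F_es Y.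
have [l' l'P] := choice_fun (fun i => full_lift (comp g (l i))).
have l'n i j (u : hom i j) : comp (l' j) (fmor D u) = l' i.
  by apply: faithful_inj; rewrite fmor_comp !l'P -comp_assoc (ln _ _ u).
by split; exact: (Cocone l'n).
Qed.

Lemma cocone_extend (C : category) (D : functor X C)
    (c : cocone (comp_functor D F)) :
  exists l : forall t, hom (D t) (apex c),
    (forall t t' (u : hom t t'), comp (l t') (fmor D u) = l t) /\
    forall A, l (F A) = leg c A.
Proof.
have [a aP] := choice_fun (T := fun=> X') (P := fun t A => isomorphic (F A) t) F_es.
have [p pP] := choice_fun aP.
have [q pq] := choice_fun pP.
pose l t := comp (leg c (a t)) (fmor D (q t)).
(* The leg at [t] does not depend on the arrow from [t] to the image of [F]: by fullness, two such
   arrows differ by an arrow of [X']. Naturality follows. *)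
have lE A t (f : hom t (F A)) : comp (leg c A) (fmor D f) = l t.
  have [w wE] := full_lift (comp f (p t)); rewrite /l -(leg_nat c w) /= wE.
  by rewrite -comp_assoc -fmor_comp -comp_assoc (proj2 (pq t)) comp_idr.
exists l; split=> [t t' u|A].
  by rewrite /l -comp_assoc -fmor_comp lE.
by rewrite -(lE A _ (idm _)) fmor_id comp_idr.
Qed.

Lemma has_colimit_precomp (C : category) (D : functor X C) :
  has_colimit (comp_functor D F) -> has_colimit D.
Proof.
move=> [c c_colim]; have [l [ln lF]] := cocone_extend c.
exists (Cocone ln); apply: colimit_intro => /= [Y m mn|Y u v uv].
  have [A B w|u uP] := colimit_exists c_colim (m := fun A => m (F A)).
    exact: mn.
  exists u => t; have [A [p [q [_ pq]]]] := F_es t.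
  by rewrite -(ln _ _ q) lF comp_assoc uP mn.
by apply: (colimit_unique c_colim) => A; rewrite -!lF uv.
Qed.

End WeakEquivalence.

(** * Categories of types as categories in the model *)

Definition arrows (X : category) := {A : X & {B : X & hom A B}}.

Definition arrow (X : category) (A B : X) (f : hom A B) : arrows X :=
  existT _ A (existT _ B f).

Lemma arrow_inj (X : category) (A B : X) : injective (@arrow X A B).
Proof. by move=> f g e; exact: (inj_pair2 _ _ _ _ _ (inj_pair2 _ _ _ _ _ e)). Qed.

Section SetCategoryOf.
Variables (S : set_theory) (X : category) (x : S) (code : arrows X -> S).
Hypotheses (code_inj : injective code) (code_in : forall t, code t ∈ x).

Let sep (P : S -> Prop) : S :=
  proj1_sig (constructive_indefinite_description _ (separation P x)).

Let sepP P z : z ∈ sep P <-> z ∈ x /\ P z.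
Proof. exact: (proj2_sig (constructive_indefinite_description _ (separation P x))). Qed.

(** An object is coded by its identity, so that a single injection [code] handles objects and
    arrows. *)
Let obs := sep (fun z => exists A : X, code (arrow (idm A)) = z).
Let mors := sep (fun z => exists t, code t = z).

Let dec_ex (z : El obs) : exists A : X, code (arrow (idm A)) = val z.
Proof. by have [] := proj1 (sepP _ _) (proj2_sig z). Qed.

Let dec (z : El obs) : X := proj1_sig (constructive_indefinite_description _ (dec_ex z)).

Let decP z : code (arrow (idm (dec z))) = val z.
Proof. exact: (proj2_sig (constructive_indefinite_description _ (dec_ex z))). Qed.

Let dec_inj : injective dec.
Proof. by move=> z w e; apply: El_inj; rewrite -!decP e. Qed.

Let dec_surj (A : X) : exists z, dec z = A.
Proof.
have zo : code (arrow (idm A)) ∈ obs by apply/sepP; split=> //; exists A.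
by exists (to_El zo); have /code_inj[] := decP (to_El zo).
Qed.

Let homs (z w : El obs) :=
  sep (fun y => exists h : hom (dec z) (dec w), code (arrow h) = y).

Let hdec_ex z w (y : El (homs z w)) :
  exists h : hom (dec z) (dec w), code (arrow h) = val y.
Proof. by have [] := proj1 (sepP _ _) (proj2_sig y). Qed.

Let hdec z w (y : El (homs z w)) : hom (dec z) (dec w) :=
  proj1_sig (constructive_indefinite_description _ (hdec_ex y)).

Let hdecP z w (y : El (homs z w)) : code (arrow (hdec y)) = val y.
Proof. exact: (proj2_sig (constructive_indefinite_description _ (hdec_ex y))). Qed.

Let henc_in z w (h : hom (dec z) (dec w)) : code (arrow h) ∈ homs z w.
Proof. by apply/sepP; split=> //; exists h. Qed.

Let henc z w (h : hom (dec z) (dec w)) : El (homs z w) := to_El (henc_in h).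

Let hencK z w : cancel (@henc z w) (@hdec z w).
Proof. by move=> h; apply: arrow_inj; apply: code_inj; rewrite hdecP. Qed.

Let hdecK z w : cancel (@hdec z w) (@henc z w).
Proof. by move=> y; apply: El_inj; rewrite /= hdecP. Qed.

Let mor_homs f : f ∈ mors <-> exists z w, f ∈ homs z w.
Proof.
split=> [/sepP[fx [[A [B h]] <-]]|[z [w /sepP[fx [h <-]]]]].
  have [z ez] := dec_surj A; have [w ew] := dec_surj B; subst A B.
  by exists z, w; apply: henc_in.
by apply/sepP; split=> //; exists (arrow h).
Qed.

Let homs_disjoint f z w z' w' :
  f ∈ homs z w -> f ∈ homs z' w' -> z = z' /\ w = w'.
Proof.
move=> /sepP[_ [h <-]] /sepP[_ [h' /code_inj e]].
split; apply: dec_inj; first by case: e.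
by have := congr1 (fun t : arrows X => projT1 (projT2 t)) e.
Qed.

Let sid z : El (homs z z) := henc (idm (dec z)).
Let scomp z w v (g : El (homs w v)) (f : El (homs z w)) : El (homs z v) :=
  henc (comp (hdec g) (hdec f)).

Let scomp_idl z w (f : El (homs z w)) : scomp (sid w) f = f.
Proof. by rewrite /scomp hencK comp_idl hdecK. Qed.

Let scomp_idr z w (f : El (homs z w)) : scomp f (sid z) = f.
Proof. by rewrite /scomp hencK comp_idr hdecK. Qed.

Let scomp_assoc z w v y (h : El (homs v y)) (g : El (homs w v))
  (f : El (homs z w)) : scomp h (scomp g f) = scomp (scomp h g) f.
Proof. by rewrite /scomp !hencK comp_assoc. Qed.

(** A code determines the domain and codomain of its arrow, so the hom-sets cut out of [x] are
    disjoint. Index categories can thus be built from types and then replaced by categories in the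
    model. *)
Lemma set_category_of : exists (X' : set_category S) (F : functor X' X),
  [/\ fully_faithful F, essentially_surjective F,
      subset (ob X') x, subset (mor X') x &
      exists f : El (mor X') -> arrows X, injective f].
Proof.
pose X' := SetCategory mor_homs homs_disjoint scomp_idl scomp_idr scomp_assoc.
have F1 (z : X') : hdec (sid z) = idm (dec z) by exact: hencK.
have F2 (z w v : X') (g : hom w v) (f : hom z w) :
  hdec (scomp g f) = comp (hdec g) (hdec f) by exact: hencK.
exists X', (@Functor X' X dec hdec F1 F2); split.
- by move=> z w; exists (@henc z w).
- move=> A; have [z <-] := dec_surj A; exists z.
  by exists (idm _), (idm _); rewrite comp_idl.
- by move=> z /sepP[].
- by move=> z /sepP[].
have [|f fP] := choice_fun (I := El mors) (T := fun=> arrows X)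
  (P := fun z t => code t = val z); first by move=> z; have [] := proj1 (sepP _ _) (proj2_sig z).
by exists f => a b e; apply: El_inj; rewrite -!fP e.
Qed.

End SetCategoryOf.

(** * Diagrams indexed by graphs *)

(** Cocones need only be checked on generating arrows; indexing by a graph avoids composition laws,
    and [incidence_functor] turns such a diagram back into a functor. *)
Record graph_diagram (C : category) := GraphDiagram {
  vtx : Type;
  edge : Type;
  src : edge -> vtx;
  tgt : edge -> vtx;
  vobj : vtx -> C;
  emor : forall e, hom (vobj (src e)) (vobj (tgt e))
}.

Section GraphColimits.
Variables (C : category) (D : graph_diagram C).

Definition graph_cocone (Y : C) (l : forall v : vtx D, hom (vobj v) Y) :=
  forall e : edge D, comp (l (tgt e)) (emor e) = l (src e).

Definition graph_colimit (Q : C) (l : forall v : vtx D, hom (vobj v) Q) :=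
  [/\ graph_cocone l,
      forall Y m, graph_cocone m ->
        exists u : hom Q Y, forall v, comp u (l v) = m v &
      forall Y (u u' : hom Q Y),
        (forall v, comp u (l v) = comp u' (l v)) -> u = u'].

Definition has_graph_colimit := exists Q l, @graph_colimit Q l.

Let X := (vtx D + edge D)%type.

(* The category with the vertices and edges of the graph as objects and, besides
   identities, two arrows out of every edge, to its source ([true]) and to its
   target ([false]).  Unlike the free category on the graph, it has fewer than
   [kappa] arrows whenever the graph does, even for countable [kappa]. *)
Definition incidence_hom (a b : X) : Type :=
  match a, b with
  | inl v, inl w => v = w
  | inr e, inr e' => e = e'
  | inr e, inl v => {d : bool | (if d then src e else tgt e) = v}
  | inl _, inr _ => False
  end.

Definition incidence_id (a : X) : incidence_hom a a :=
  match a with inl _ => erefl | inr _ => erefl end.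

Definition incidence_comp (a b c : X) :
  incidence_hom b c -> incidence_hom a b -> incidence_hom a c.
Proof.
case: a b c => [v|e] [w|e'] [u|e''] //=.
- by move=> wu vw; exact: etrans vw wu.
- by move=> wu [d dw]; exists d; exact: etrans dw wu.
- by move=> g ee'; rewrite ee'; exact: g.
- by move=> g f; exact: etrans f g.
Defined.

Let X_idl a b (f : incidence_hom a b) : incidence_comp (incidence_id b) f = f.
Proof. by case: a b f => [v|e] [w|e'] //= f; case: _ / f || (case: f => d; case: _ /). Qed.

Let X_idr a b (f : incidence_hom a b) : incidence_comp f (incidence_id a) = f.
Proof. by case: a b f => [v|e] [w|e'] //= f; case: _ / f. Qed.

Let X_assoc a b c d (h : incidence_hom c d) (g : incidence_hom b c)
  (f : incidence_hom a b) :
  incidence_comp h (incidence_comp g f) = incidence_comp (incidence_comp h g) f.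
Proof.
case: a b c d h g f => [v|e] [w|e'] [u|e''] [x|e'''] //= h g f.
- exact: proof_irrelevance.
- by case: f => k p; congr exist; apply: proof_irrelevance.
- by case: _ / f h g.
- by case: _ / f g h; case: _ /.
- exact: proof_irrelevance.
Qed.

Definition incidence : category := Category X_idl X_idr X_assoc.

Lemma arrows_incidence_size (P : Type -> Prop) : size_class P ->
  P (vtx D) -> P (edge D) -> P (arrows incidence).
Proof.
move=> Ps PV PE.
(* An arrow is the identity of a vertex, the identity of an edge, or an edge together with the
   choice of an endpoint. *)
pose f (t : arrows incidence) : (vtx D + (edge D + edge D * bool))%type :=
  match t with
  | existT (inl v) _ => inl v
  | existT (inr e) (existT (inl v) d) => inr (inr (e, proj1_sig d))
  | existT (inr e) (existT (inr _) _) => inr (inl e)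
  end.
apply: (size_inj Ps (f := f)); last first.
  apply: (size_sum Ps) => //; apply: (size_sum Ps) => //.
  exact: (size_prod Ps PE (size_bool Ps)).
case=> [[v|e] [[w|e'] g]] [[v'|e1] [[w'|e1'] g']] //=.
- by move=> [e]; subst v'; case: _ / g; case: _ / g'.
- case: g g' => [d p] [d' p'] /= [ee dd]; subst e1 d'.
  by case: _ / p; case: _ / p'.
- by move=> [ee]; subst e1; case: _ / g; case: _ / g'.
Qed.

Definition incidence_obj (a : X) : C :=
  match a with inl v => vobj v | inr e => vobj (src e) end.

Definition incidence_mor (a b : X) :
  incidence_hom a b -> hom (incidence_obj a) (incidence_obj b).
Proof.
case: a b => [v|e] [w|e'] //=.
- by case: _ /; exact: idm.
- by case=> -[]; case: _ /; [exact: idm|exact: emor].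
- by case: _ /; exact: idm.
Defined.

Let mor_id a : incidence_mor (incidence_id a) = idm (incidence_obj a).
Proof. by case: a. Qed.

Let mor_comp a b c (g : incidence_hom b c) (f : incidence_hom a b) :
  incidence_mor (incidence_comp g f) = comp (incidence_mor g) (incidence_mor f).
Proof.
case: a b c g f => [v|e] [w|e'] [u|e''] //= g f.
- by case: _ / g f; case: _ /; rewrite comp_idl.
- by case: _ / g f => -[[]]; case: _ /; rewrite comp_idl.
- by case: _ / f g => g; rewrite comp_idr.
- by case: _ / g f; case: _ /; rewrite comp_idl.
Qed.

Definition incidence_functor : functor incidence C :=
  @Functor incidence C incidence_obj incidence_mor mor_id mor_comp.

Lemma cocone_incidence (Y : C) (l : forall v : vtx D, hom (vobj v) Y) :
  graph_cocone l -> exists l' : forall a, hom (incidence_functor a) Y,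
   (forall a b (u : hom a b), comp (l' b) (fmor incidence_functor u) = l' a) /\
   forall v, l' (inl v) = l v.
Proof.
move=> lc; exists (fun a => match a return hom (incidence_obj a) Y with
  inl v => l v | inr e => l (src e) end).
split=> // -[v|e] [w|e'] //= u.
- by case: _ / u; rewrite comp_idr.
- by case: u => -[]; case: _ / => /=; rewrite ?comp_idr.
- by case: _ / u; rewrite comp_idr.
Qed.

Lemma incidence_cocone (c : cocone incidence_functor) :
  graph_cocone (fun v => leg c (inl v)) /\
  forall e, leg c (inl (src e)) = leg c (inr e).
Proof.
pose s e : @hom incidence (inr e) (inl (src e)) :=
  exist (fun d : bool => _ = _) true erefl.
pose t e : @hom incidence (inr e) (inl (tgt e)) :=
  exist (fun d : bool => _ = _) false erefl.
have sE e : leg c (inl (src e)) = leg c (inr e).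
  by rewrite -(leg_nat c (s e)) /= comp_idr.
by split=> // e; rewrite sE -(leg_nat c (t e)).
Qed.

Lemma graph_colimit_incidence : has_colimit incidence_functor -> has_graph_colimit.
Proof.
move=> [c c_colim]; exists (apex c), (fun v => leg c (inl v)).
have [cc cs] := incidence_cocone c.
split=> // [Y m mc|Y u u' uu'].
  have [m' [m'n m'E]] := cocone_incidence mc.
  by have [u uP] := colimit_exists c_colim m'n; exists u => v; rewrite -m'E; exact: (uP (inl v)).
by apply: (colimit_unique c_colim) => -[v|e]; rewrite -?cs; exact: uu'.
Qed.

End GraphColimits.

(** * Small and filtered diagrams *)

Section SmallDiagrams.
Variables (S : set_theory) (kappa U : S).
Hypotheses (U_universe : universe U) (kappa_regular : regular_cardinal kappa).

Let ks := ksmall_size kappa_regular.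
Let us := usmall_size U_universe.

Lemma usmall_category (X : category) : usmall U (arrows X) ->
  exists (X' : set_category S) (F : functor X' X),
    [/\ small U X', fully_faithful F, essentially_surjective F &
        exists f : El (mor X') -> arrows X, injective f].
Proof.
move=> [x xU [f f_inj fx]].
have [X' [F [Fff Fes ox mx cX]]] := set_category_of f_inj fx.
by exists X', F; split=> //; split; apply: universe_subset xU _.
Qed.

Lemma ksmall_category (X : category) : ksmall kappa (arrows X) ->
  exists (X' : set_category S) (F : functor X' X),
    [/\ card_lt (mor X') kappa, fully_faithful F & essentially_surjective F].
Proof.
move=> sX; have [a [f [g fK gK]]] := ksmall_card kappa_regular sX.
have g_inj : injective (fun t => val (g t)).
  by move=> t t' /El_inj; apply: can_inj gK _ _.
have [X' [F [Fff Fes _ _ [h h_inj]]]] :=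
  set_category_of g_inj (fun t => proj2_sig (g t)).
exists X', F; split=> //; apply: ksmall_card_lt => //.
exact: (size_inj ks h_inj).
Qed.

Lemma small_has_colimit (X C : category) (D : functor X C) :
  (forall (J : set_category S) (D : functor J C), small U J -> has_colimit D) ->
  usmall U (arrows X) -> has_colimit D.
Proof.
move=> cC /usmall_category[X' [F [sX' Fff Fes _]]].
by apply: (has_colimit_precomp Fff Fes); apply: cC.
Qed.

Lemma small_has_graph_colimit (C : category) (D : graph_diagram C) :
  (forall (J : set_category S) (D : functor J C), small U J -> has_colimit D) ->
  usmall U (vtx D) -> usmall U (edge D) -> has_graph_colimit D.
Proof.
move=> cC sV sE; apply: graph_colimit_incidence.
by apply: small_has_colimit => //; apply: arrows_incidence_size.
Qed.

Lemma arrows_mor (J : set_category S) :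
  exists f : arrows J -> El (mor J), injective f.
Proof.
have h (t : arrows J) : val (projT2 (projT2 t)) ∈ mor J.
  apply/mor_homset; case: t => A [B [f fAB]] /=; by exists A, B.
exists (fun t => to_El (h t)).
move=> [A [B [f fAB]]] [A' [B' [f' fAB']]] [/= ff]; subst f'.
have [eA eB] := hom_disjoint fAB fAB'; subst A' B'.
by rewrite (proof_irrelevance _ fAB fAB').
Qed.

Lemma obj_arrows (X : category) : exists f : X -> arrows X, injective f.
Proof. by exists (fun A => arrow (idm A)) => A B []. Qed.

(** * Bounds in filtered categories *)

Section Filtered.
Variables (J : set_category S) (J_filtered : filtered kappa J).

(** [filtered] quantifies over categories in the model; the weak equivalence from [ksmall_category]
    extends the cocone to any index category of that size. *)
Lemma filtered_cocone (X : category) (F : functor X J) :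
  ksmall kappa (arrows X) -> inhabited (cocone F).
Proof.
move=> /ksmall_category[X' [G [sX' Gff Ges]]].
have [c] := J_filtered (comp_functor F G) sX'.
by have [l [ln _]] := cocone_extend Gff Ges c; split; exact: (Cocone ln).
Qed.

(** Applied below to a discrete graph, a fan out of one vertex and a parallel pair. *)
Lemma filtered_graph (D : graph_diagram J) :
  ksmall kappa (vtx D) -> ksmall kappa (edge D) ->
  exists k (l : forall v : vtx D, hom (vobj v) k), graph_cocone l.
Proof.
move=> sV sE.
have [c] := filtered_cocone (incidence_functor D) (arrows_incidence_size ks sV sE).
have [cc _] := incidence_cocone c.
by exists (apex c), (fun v => leg c (inl v)).
Qed.

Lemma filtered_bound (I : Type) (d : I -> J) : ksmall kappa I ->
  exists k, inhabited (forall i, hom (d i) k).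
Proof.
move=> sI.
pose D := @GraphDiagram J I void (@of_void I) (@of_void I) d
  (fun e => match e with end).
by have [k [l _]] := @filtered_graph D sI (size_void ks); exists k.
Qed.

Lemma filtered_bound2 (j k : J) : exists l, inhabited (hom j l * hom k l).
Proof.
have [l [f]] := filtered_bound (fun b : bool => if b then j else k) (size_bool ks).
by exists l; split; split; [exact: (f true)|exact: (f false)].
Qed.

Lemma filtered_span (I : Type) (j : J) (k : I -> J) (u : forall i, hom j (k i)) :
  ksmall kappa I ->
  exists l (w : hom j l) (v : forall i, hom (k i) l), forall i, comp (v i) (u i) = w.
Proof.
move=> sI.
pose D := @GraphDiagram J (option I) I (fun=> None) Some
  (fun o => if o is Some i then k i else j) u.
have [l [f fc]] := @filtered_graph D (size_option ks sI) sI.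
by exists l, (f None), (fun i => f (Some i)).
Qed.

Lemma filtered_coequalize (j k : J) (u v : hom j k) :
  exists l (w : hom k l), comp w u = comp w v.
Proof.
pose D := @GraphDiagram J bool bool (fun=> true) (fun=> false)
  (fun b => if b then j else k) (fun b => if b then u else v).
have [l [f fc]] := @filtered_graph D (size_bool ks) (size_bool ks).
by exists l, (f false); rewrite (fc true) (fc false).
Qed.

End Filtered.

Lemma filtered_has_colimit (X C : category) (D : functor X C) :
  has_filtered_colimits kappa U C -> usmall U (arrows X) ->
  (forall (I : category) (F : functor I X),
     ksmall kappa (arrows I) -> inhabited (cocone F)) ->
  has_colimit D.
Proof.
move=> cC /usmall_category[X' [F [sX' Fff Fes _]]] fX.
apply: (has_colimit_precomp Fff Fes); apply: cC => // I G sI.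
apply: (cocone_lift Fff Fes).
apply: fX; have [f f_inj] := arrows_mor I; apply: (size_inj ks f_inj).
exact: card_lt_ksmall.
Qed.

(* Compactness spelled out on elements, so that it makes sense in any category. *)
Definition ecompact (C : category) (A : C) :=
  forall (J : set_category S) (D : functor J C) (c : cocone D),
    small U J -> filtered kappa J -> is_colimit c ->
    (forall f : hom A (apex c), exists j g, comp (leg c j) g = f) /\
    (forall j (f g : hom A (D j)), comp (leg c j) f = comp (leg c j) g ->
       exists k (u : hom j k), comp (fmor D u) f = comp (fmor D u) g).

(** The power set of the singleton of [kappa] is a set of truth values in the model; maps into it
    test elements of colimits of sets. *)
Lemma truth_values : exists (w : S) (P : El w -> Prop) (ch : Prop -> El w),
  (forall Q, P (ch Q) <-> Q) /\ forall t t', (P t <-> P t') -> t = t'.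
Proof.
have [p pP] := pairing kappa kappa; have [w wP] := powerset p.
have [|ch chP] := choice_fun (I := Prop) (T := fun=> El w)
  (P := fun Q t => kappa ∈ val t <-> Q).
  move=> Q; have [y yP] := separation (fun=> Q) p.
  have yw : y ∈ w by apply/wP => z /yP[].
  by exists (to_El yw); rewrite /= yP pP; tauto.
exists w, (fun t => kappa ∈ val t), ch; split=> // t t' tt'.
apply: El_inj; apply: extensionality => z.
have sub (s : El w) : z ∈ val s -> z = kappa.
  by move=> zs; have /pP[] := proj1 (wP _) (proj2_sig s) z zs.
by split=> zt; have zk := sub _ zt; rewrite zk in zt *; apply/tt'.
Qed.

(** * Filtered colimits of sets *)

Section SetColimits.
Variables (J : set_category S) (J_filtered : filtered kappa J).
Variables (D : functor J (SET S)) (c : cocone D).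

(** The characteristic map of the union of the images of the legs and the constant map true agree on
    every leg, hence are equal. *)
Lemma SET_colimit_surj : is_colimit c ->
  forall x : El (apex c), exists j y, leg c j y = x.
Proof.
move=> c_colim x; have [w [P [ch [chP _]]]] := truth_values.
pose a : @hom (SET S) (apex c) w := fun=> ch True.
pose b : @hom (SET S) (apex c) w := fun x => ch (exists j y, leg c j y = x).
have : a = b.
  apply: (colimit_unique c_colim) => j; apply: functional_extensionality => y.
  congr ch; apply: propositional_extensionality; split=> // _.
  by exists j, y.
by move=> /(congr1 (fun h : El (apex c) -> El w => P (h x))); rewrite /a /b => e;
   apply/chP; rewrite -e; apply/chP.
Qed.

(* For fixed [f], the predicate "[g] becomes equal to [f] at some later stage"
   is compatible with the transition maps, so it factors through the colimit. *)
Lemma SET_colimit_equal : is_colimit c ->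
  forall j (f g : El (D j)), leg c j f = leg c j g ->
  exists k (u : hom j k), fmor D u f = fmor D u g.
Proof.
move=> c_colim j f g fg; have [w [P [ch [chP ch_eq]]]] := truth_values.
pose R k (x : El (D k)) := exists l (u : hom k l) (v : hom j l),
  fmor D u x = fmor D v f.
have fmorE (a b d : J) (u : hom b d) (v : hom a b) x :
  fmor D u (fmor D v x) = fmor D (comp u v) x by rewrite fmor_comp.
pose m k : @hom (SET S) (D k) w := fun x => ch (R k x).
have [k l v|h hm] := colimit_exists c_colim (m := m).
  apply: functional_extensionality => x; apply: ch_eq; rewrite !chP.
  split=> [[p [u [u' e]]]|[p [u [u' e]]]].
    by exists p, (comp u v), u'; rewrite -fmorE.
  have [q [[s t]]] := filtered_bound2 J_filtered l p.
  have [r [z zE]] := filtered_coequalize J_filtered (comp s v) (comp t u).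
  exists r, (comp z s), (comp (comp z t) u').
  by rewrite fmorE -comp_assoc zE -[in RHS]fmorE -e fmorE comp_assoc.
have hE k x : h (leg c k x) = m k x by rewrite -hm.
have /chP[k [u [v e]]] : P (m j g).
  by rewrite -hE -fg hE; apply/chP; exists j, (idm j), (idm j).
(* So far [g] along [u] meets [f] along a possibly different arrow [v]; coequalizing the two leaves
   a single transition map. *)
have [l [z zE]] := filtered_coequalize J_filtered u v.
by exists l, (comp z u); rewrite -[RHS]fmorE e fmorE zE.
Qed.

Lemma SET_colimit_intro :
  (forall x : El (apex c), exists j y, leg c j y = x) ->
  (forall j (f g : El (D j)), leg c j f = leg c j g ->
     exists k (u : hom j k), fmor D u f = fmor D u g) ->
  is_colimit c.
Proof.
move=> c_surj c_eq; apply: colimit_intro => [Y m mn|Y u v uv].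
  have mE a b (u : hom a b) x : m b (fmor D u x) = m a x by rewrite -(mn _ _ u).
  have lE a b (u : hom a b) x : leg c b (fmor D u x) = leg c a x.
    by rewrite -(leg_nat c u).
  have key a b x y : leg c a x = leg c b y -> m a x = m b y.
    have [k [[u v]]] := filtered_bound2 J_filtered a b.
    rewrite -(lE _ _ u) -(lE _ _ v) -(mE _ _ u) -(mE _ _ v) => /c_eq[l [w e]].
    by rewrite -(mE _ _ w) e mE.
  have [|h hP] := choice_fun (I := El (apex c)) (T := fun=> El Y)
      (P := fun x y => forall j z, leg c j z = x -> y = m j z).
    move=> x; have [j [y yx]] := c_surj x; exists (m j y) => k z zx.
    by apply: key; rewrite yx.
  by exists h => j; apply: functional_extensionality => x; apply: hP.
apply: functional_extensionality => x; have [j [y <-]] := c_surj x.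
exact: (congr1 (fun h : El (D j) -> El Y => h y) (uv j)).
Qed.

End SetColimits.

Lemma compactE (C : set_category S) (A : C) : compact kappa U A <-> ecompact A.
Proof.
split=> cA J D => [c sJ fJ|sJ fJ c] c_colim.
  have cS := cA J D sJ fJ c c_colim; split.
    by move=> f; exact: (SET_colimit_surj cS f).
  by move=> j f g; exact: (SET_colimit_equal fJ cS).
have [c1 c2] := cA J D c sJ fJ c_colim.
exact: (SET_colimit_intro fJ (c := map_cocone (hom_functor A) c)).
Qed.

End SmallDiagrams.

(** * Colimits of compact objects *)

Section CompactObjects.
Variables (S : set_theory) (kappa U : S).
Hypotheses (U_universe : universe U) (kappa_regular : regular_cardinal kappa).
Variable C : category.

Let ks := ksmall_size kappa_regular.
Let us := usmall_size U_universe.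

Section FilteredColimit.
Variables (J : set_category S) (D : functor J C) (c : cocone D).
Hypotheses (J_small : small U J) (J_filtered : filtered kappa J).
Hypothesis c_colim : is_colimit c.

(** Each arrow factors through its own stage; fewer than [kappa] stages have a common bound. *)
Lemma compact_family_factor (I : Type) (A : I -> C)
    (f : forall i, hom (A i) (apex c)) :
  ksmall kappa I -> (forall i, ecompact kappa U (A i)) ->
  exists j (g : forall i, hom (A i) (D j)), forall i, comp (leg c j) (g i) = f i.
Proof.
move=> sI cA.
have [j jP] := choice_fun (fun i =>
  proj1 (cA i J D c J_small J_filtered c_colim) (f i)).
have [g gP] := choice_fun jP.
have [k [u]] := filtered_bound kappa_regular J_filtered j sI.
exists k, (fun i => comp (fmor D (u i)) (g i)) => i.
by rewrite comp_assoc leg_nat gP.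
Qed.

(** Each pair is equalized by its own arrow out of [j]; completing these arrows to one cocone gives
    a common composite [w]. *)
Lemma compact_family_equal (I : Type) (A : I -> C) (j : J)
    (f g : forall i, hom (A i) (D j)) :
  ksmall kappa I -> (forall i, ecompact kappa U (A i)) ->
  (forall i, comp (leg c j) (f i) = comp (leg c j) (g i)) ->
  exists k (u : hom j k), forall i, comp (fmor D u) (f i) = comp (fmor D u) (g i).
Proof.
move=> sI cA fg.
have [k kP] := choice_fun (fun i =>
  proj2 (cA i J D c J_small J_filtered c_colim) j _ _ (fg i)).
have [u uP] := choice_fun kP.
have [l [w [v vP]]] :=
  filtered_span kappa_regular J_filtered u sI.
exists l, w => i; rewrite -(vP i) fmor_comp -!comp_assoc.
by congr comp; apply: uP.
Qed.

(** After all vertices are factored through one stage, the cocone equations, one per edge, hold in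
    the colimit and hence at a later stage. *)
Lemma compact_graph_factor (G : graph_diagram C)
    (m : forall v : vtx G, hom (vobj v) (apex c)) :
  ksmall kappa (vtx G) -> ksmall kappa (edge G) ->
  (forall v : vtx G, ecompact kappa U (vobj v)) -> graph_cocone m ->
  exists j (g : forall v : vtx G, hom (vobj v) (D j)),
    graph_cocone g /\ forall v, comp (leg c j) (g v) = m v.
Proof.
move=> sV sE cV mc.
have [j [g gP]] := compact_family_factor m sV cV.
have [e|k [u uP]] := @compact_family_equal (edge G) (fun e => vobj (src e)) j
  (fun e => comp (g (tgt e)) (emor e)) (fun e => g (src e)) sE (fun e => cV (src e)).
  by rewrite comp_assoc !gP mc.
exists k, (fun v => comp (fmor D u) (g v)); split=> [e|v].
  by rewrite -comp_assoc uP.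
by rewrite comp_assoc leg_nat gP.
Qed.

End FilteredColimit.

Lemma graph_colimit_compact (G : graph_diagram C) (Q : C)
    (l : forall v : vtx G, hom (vobj v) Q) :
  ksmall kappa (vtx G) -> ksmall kappa (edge G) ->
  (forall v : vtx G, ecompact kappa U (vobj v)) -> graph_colimit l ->
  ecompact kappa U Q.
Proof.
move=> sV sE cV [lc l_ex l_uniq] J D c sJ fJ c_colim; split.
  move=> f; have mc : graph_cocone (fun v => comp f (l v)).
    by move=> e; rewrite -comp_assoc lc.
  have [j [g [gc gP]]] := compact_graph_factor sJ fJ c_colim sV sE cV mc.
  have [u uP] := l_ex _ g gc; exists j, u; apply: l_uniq => v.
  by rewrite -comp_assoc uP gP.
move=> j f g fg.
have [v|k [u uP]] := compact_family_equal sJ fJ c_colim (j := j)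
  (f := fun v => comp f (l v)) (g := fun v => comp g (l v)) sV cV.
  by rewrite !comp_assoc fg.
by exists k, u; apply: l_uniq => v; rewrite -!comp_assoc.
Qed.

(** Among accessible categories this condition singles out the locally presentable ones, and it
    passes along an extension in both directions. *)
Definition compact_graph_colimits := forall G : graph_diagram C,
  ksmall kappa (vtx G) -> ksmall kappa (edge G) ->
  (forall v : vtx G, ecompact kappa U (vobj v)) -> has_graph_colimit G.

Hypothesis C_filtered_colimits : has_filtered_colimits kappa U C.

(** * Small graphs of compact objects, as directed unions of subgraphs *)

Section GraphOfCompacts.
Hypothesis K_colimits : compact_graph_colimits.
Variable G : graph_diagram C.
Hypotheses (V_small : usmall U (vtx G)) (E_small : usmall U (edge G)).
Hypothesis V_compact : forall v : vtx G, ecompact kappa U (vobj v).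

Let X := {P : vtx G + edge G -> Prop | ksmall kappa {x | P x}}.

(* A subgraph is given by an arbitrary set of vertices and edges; edges whose
   endpoints are missing are ignored. *)
Let sub_cocone (P : X) (Y : C) (m : forall v, proj1_sig P (inl v) -> hom (vobj v) Y) :=
  forall e, proj1_sig P (inr e) -> forall ps pt,
    comp (m (tgt e) pt) (emor e) = m (src e) ps.

Let sub_colimit (P : X) :
  exists Q (l : forall v, proj1_sig P (inl v) -> hom (vobj v) Q),
    [/\ sub_cocone l,
        forall Y m, sub_cocone m ->
          exists u : hom Q Y, forall v p, comp u (l v p) = m v p &
        forall Y (u u' : hom Q Y),
          (forall v p, comp u (l v p) = comp u' (l v p)) -> u = u'].
Proof.
case: P => P sP.
pose V := {v | P (inl v)}.
pose E := {e | [/\ P (inr e), P (inl (src e)) & P (inl (tgt e))]}.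
pose s (e : E) : V := exist (fun v => P (inl v)) (src (proj1_sig e))
  (let: And3 _ p _ := proj2_sig e in p).
pose t (e : E) : V := exist (fun v => P (inl v)) (tgt (proj1_sig e))
  (let: And3 _ _ p := proj2_sig e in p).
pose H := @GraphDiagram C V E s t (fun v => vobj (proj1_sig v))
  (fun e => emor (proj1_sig e)).
pose f (v : V) : {x | P x} := exist P (inl (proj1_sig v)) (proj2_sig v).
pose g (e : E) : {x | P x} :=
  exist P (inr (proj1_sig e)) (let: And3 p _ _ := proj2_sig e in p).
have [|||Q [l [lc l_ex l_uniq]]] := K_colimits (G := H).
- apply: (size_inj ks (f := f)) sP => v w /(congr1 (@proj1_sig _ _)) [].
  exact: sig_val_inj.
- apply: (size_inj ks (f := g)) sP => v w /(congr1 (@proj1_sig _ _)) [].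
  exact: sig_val_inj.
- by move=> v; apply: V_compact.
exists Q, (fun v p => l (exist _ v p)); split.
- by move=> e pe ps pt; exact: (lc (exist _ e (And3 pe ps pt))).
- move=> Y m mc; have [|u uP] := l_ex Y (fun v => m (proj1_sig v) (proj2_sig v)).
    by case=> e [pe ps pt]; apply: mc.
  by exists u => v p; exact: (uP (exist _ v p)).
by move=> Y u u' uu'; apply: l_uniq => -[v p]; apply: uu'.
Qed.

Let inclusion : category.
Proof.
apply: (@Category X (fun P Q => forall x, proj1_sig P x -> proj1_sig Q x)
  (fun P x p => p) (fun P Q R g f x p => g x (f x p)));
  by move=> *; apply: proof_irrelevance.
Defined.

Let inclusion_small : usmall U (arrows inclusion).
Proof.
have sX : usmall U X.
  exact: (size_sub us _ (usmall_pred U_universe (size_sum us V_small E_small))).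
pose f (t : arrows inclusion) : X * X := (projT1 t, projT1 (projT2 t)).
apply: (size_inj us (f := f)); last exact: (size_prod us).
move=> [P [Q p]] [P' [Q' p']] [/= eP eQ]; subst P' Q'.
by rewrite (proof_irrelevance (forall x, proj1_sig P x -> proj1_sig Q x) p p').
Qed.

(** Fewer than [kappa] subgraphs have their union as upper bound, and regularity keeps it
    [ksmall]. *)
Let inclusion_filtered (I : category) (F : functor I inclusion) :
  ksmall kappa (arrows I) -> inhabited (cocone F).
Proof.
move=> sA; have sI : ksmall kappa I.
  by have [f f_inj] := obj_arrows I; apply: (size_inj ks f_inj).
pose P x := exists i, proj1_sig (F i) x.
have sP : ksmall kappa {x | P x}.
  have [f fP] := choice_fun (fun x : {x | P x} => proj2_sig x).
  pose g (x : {x | P x}) : {i : I & {y | proj1_sig (F i) y}} :=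
    existT _ (f x) (exist _ (proj1_sig x) (fP x)).
  apply: (size_inj ks (f := g)).
    move=> x y e; apply: sig_val_inj.
    exact: (congr1 (fun t : {i : I & {y | proj1_sig (F i) y}} =>
      proj1_sig (projT2 t)) e).
  by apply: (size_sigma ks) => // i; apply: (proj2_sig (F i)).
split; apply: (@Cocone I inclusion F (exist _ P sP) (fun i x p => ex_intro _ i p)).
by move=> i j u; exact: (proof_irrelevance (forall x, proj1_sig (F i) x -> P x)).
Qed.

Let image_sub (I : Type) (g : I -> vtx G + edge G) (sI : ksmall kappa I) : X :=
  exist _ (fun x => exists i, g i = x) (size_image ks g sI).

Lemma compact_graph_has_colimit : has_graph_colimit G.
Proof.
have [Q QP] := choice_fun sub_colimit.
have [l lP] := choice_fun QP.
have l_nat (P P' : inclusion) (s : hom P P') : exists u : hom (Q P) (Q P'),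
    forall v p, comp u (l P v p) = l P' v (s _ p).
  have [_ l_ex _] := lP P; have [lc' _ _] := lP P'.
  by apply: l_ex => e pe ps pt; apply: lc'; apply: s.
have [T TP] := choice_fun (fun P => choice_fun (fun P' => choice_fun (l_nat P P'))).
have l_uniq (P : inclusion) Y (u u' : hom (Q P) Y) :
    (forall v p, comp u (l P v p) = comp u' (l P v p)) -> u = u'.
  by have [_ _] := lP P; apply.
have T_id (P : inclusion) : T P P (idm P) = idm (Q P).
  by apply: l_uniq => v p; rewrite TP comp_idl.
have T_comp (P P' P'' : inclusion) (g : hom P' P'') (f : hom P P') :
    T P P'' (comp g f) = comp (T P' P'' g) (T P P' f).
  by apply: l_uniq => v p; rewrite -comp_assoc !TP.
pose D := @Functor inclusion C Q T T_id T_comp.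
have [c c_colim] : has_colimit D.
  by apply: (filtered_has_colimit U_universe kappa_regular D C_filtered_colimits
       inclusion_small) => I F sI; apply: inclusion_filtered.
pose pt v : X := image_sub (fun _ : unit => inl v) (size_unit ks).
have ptv v : proj1_sig (pt v) (inl v) by exists tt.
(* The leg at [v] is read off the one-vertex subgraph; by [kE] every subgraph containing [v] gives
   the same leg. *)
pose k v := comp (leg c (pt v)) (l (pt v) v (ptv v)).
have kE P v p : comp (leg c P) (l P v p) = k v.
  have s : @hom inclusion (pt v) P by move=> x [_ <-].
  rewrite /k -(leg_nat c s) -comp_assoc /= TP.
  by congr (comp _ (l P v _)); apply: proof_irrelevance.
exists (apex c), k; split.
- move=> e.
  (* The subgraph formed by [e] and its endpoints, whose colimit already satisfies the equation for
     [e]. *)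
  pose P : X := image_sub (fun o : option bool =>
    if o is Some b then inl (if b then src e else tgt e) else inr e)
    (size_option ks (size_bool ks)).
  have pe : proj1_sig P (inr e) by exists None.
  have ps : proj1_sig P (inl (src e)) by exists (Some true).
  have pt' : proj1_sig P (inl (tgt e)) by exists (Some false).
  have [lc _ _] := lP P.
  by rewrite -(kE P _ ps) -(kE P _ pt') -comp_assoc lc.
- move=> Y m mc.
  have [P|h hP] := choice_fun (I := X) (T := fun P => hom (Q P) Y)
    (P := fun P h => forall v p, comp h (l P v p) = m v).
    by have [_ l_ex _] := lP P; apply: l_ex => e *; apply: mc.
  have [P P' s|u uP] := colimit_exists c_colim (m := h).
    by apply: l_uniq => v p; rewrite -comp_assoc /= TP !hP.
  by exists u => v; rewrite /k comp_assoc uP hP.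
- move=> Y u u' uu'; apply: (colimit_unique c_colim) => P; apply: l_uniq => v p.
  by rewrite -!comp_assoc kE.
Qed.

End GraphOfCompacts.

(** * Reduction of small colimits to graphs of generators *)

Section Generators.
Variable Gen : C -> Prop.
Hypothesis Gen_small : usmall U {A | Gen A}.
Hypothesis hom_small : forall A B : C, usmall U (hom A B).
Hypothesis Gen_compact : forall A, Gen A -> ecompact kappa U A.
Hypothesis Gen_generate : forall A, exists (J : set_category S) (D : functor J C)
  (c : cocone D), [/\ small U J, filtered kappa J, forall j, Gen (D j),
                      is_colimit c & apex c = A].

(** The colimit presenting [X] yields [h] from the values of [m] on its legs. By compactness every
    arrow from a generator to [X] factors through a leg, and naturality of [m] gives the equation
    there. *)
Lemma generators_dense (X Y : C) (m : forall A, Gen A -> hom A X -> hom A Y) :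
  (forall A B (gA : Gen A) (gB : Gen B) (f : hom A B) (b : hom B X),
     m A gA (comp b f) = comp (m B gB b) f) ->
  exists h : hom X Y, forall A gA a, comp h a = m A gA a.
Proof.
have [J [D [c [sJ fJ gD c_colim eX]]]] := Gen_generate X; subst X => m_nat.
have [j k u|h hP] := colimit_exists c_colim (m := fun j => m _ (gD j) (leg c j)).
  by rewrite -(m_nat _ _ (gD j)) leg_nat.
exists h => A gA a.
have [j [b <-]] := proj1 (Gen_compact gA sJ fJ c_colim) a.
by rewrite comp_assoc hP (m_nat _ _ gA (gD j)).
Qed.

Lemma generators_separate (X Y : C) (u v : hom X Y) :
  (forall A (a : hom A X), Gen A -> comp u a = comp v a) -> u = v.
Proof.
have [J [D [c [_ _ gD c_colim eX]]]] := Gen_generate X; subst X => uv.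
by apply: (colimit_unique c_colim) => j; apply: uv.
Qed.

(* A cocone under [D] amounts to a cocone under the graph of all generators
   lying over some [D j]. *)
Lemma small_colimits_of_compact (K_colimits : compact_graph_colimits)
  (J : set_category S) (D : functor J C) : small U J -> has_colimit D.
Proof.
move=> [sOb sMor].
pose V := {j : J & {A : {A | Gen A} & hom (proj1_sig A) (D j)}}.
(* Two kinds of edges: precomposition of a generator over [D j] with an arrow [f] of generators, and
   transport of one along [u : hom j k], which is the identity on the generator. *)
pose E := ({v : V & {A : {A | Gen A} & hom (proj1_sig A) (proj1_sig (projT1 (projT2 v)))}}
           + {v : V & {j : J & hom (projT1 v) j}})%type.
pose mkV j A (gA : Gen A) (a : hom A (D j)) : V :=
  existT _ j (existT (fun A : {A | Gen A} => hom (proj1_sig A) (D j))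
    (exist _ A gA) a).
pose s (e : E) : V :=
  match e with
  | inl (existT v (existT A f)) =>
      mkV (projT1 v) _ (proj2_sig A) (comp (projT2 (projT2 v)) f)
  | inr (existT v _) => v
  end.
pose t (e : E) : V :=
  match e with
  | inl (existT v _) => v
  | inr (existT v (existT j u)) =>
      mkV j _ (proj2_sig (projT1 (projT2 v))) (comp (fmor D u) (projT2 (projT2 v)))
  end.
pose ob (v : V) : C := proj1_sig (projT1 (projT2 v)).
pose mo (e : E) : hom (ob (s e)) (ob (t e)) :=
  match e return hom (ob (s e)) (ob (t e)) with
  | inl (existT v (existT A f)) => f
  | inr (existT v (existT j u)) => idm (ob v)
  end.
pose G := @GraphDiagram C V E s t ob mo.
have sJ : usmall U J by apply: El_usmall.
have sV : usmall U V.
  by apply: (size_sigma us) => // j; apply: (size_sigma us).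
have [||v|Q [l [lc l_ex l_uniq]]] := compact_graph_has_colimit K_colimits (G := G).
- exact: sV.
- apply: (size_sum us); apply: (size_sigma us) => // v; apply: (size_sigma us) => //.
  move=> j; have [f f_inj] := arrows_mor J.
  apply: (size_inj us (f := fun h : hom (projT1 v) j => f (arrow h))).
    by move=> h h' /f_inj/arrow_inj.
  exact: El_usmall.
- exact: (Gen_compact (proj2_sig (projT1 (projT2 v)))).
(* For fixed [j] the edges of the first kind make the legs natural in the generator, so they
   assemble to an arrow out of [D j]; the second kind makes these arrows natural in [j]. *)
have [j|h hP] := choice_fun (I := J) (T := fun j => hom (D j) Q)
  (P := fun j h => forall A gA a, comp h a = l (mkV j A gA a)).
  apply: (generators_dense (m := fun A gA a => l (mkV j A gA a))) => A B gA gB f b.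
  apply/esym; exact: (lc (inl (existT _ (mkV j B gB b)
    (existT (fun A : {A | Gen A} => hom (proj1_sig A) B) (exist _ A gA) f)))).
have h_nat (j k : J) (u : hom j k) : comp (h k) (fmor D u) = h j.
  apply: generators_separate => A a gA; rewrite -comp_assoc !(hP _ _ gA).
  have := lc (inr (existT _ (mkV j A gA a) (existT _ k u))).
  by rewrite /= comp_idr.
exists (Cocone h_nat); apply: colimit_intro => /= [Y m mn|Y u u' uu'].
  have [|u uP] := l_ex Y (fun v => comp (m (projT1 v)) (projT2 (projT2 v))).
    case=> [[[j [[B gB] b]] [[A gA] f]]|[[j [[A gA] a]] [k u]]] /=.
      by rewrite comp_assoc.
    by rewrite comp_idr comp_assoc mn.
  exists u => j; apply: generators_separate => A a gA.
  by rewrite -comp_assoc (hP _ _ gA); exact: (uP (mkV j A gA a)).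
apply: l_uniq => -[j [[A gA] a]].
change (comp u (l (mkV j A gA a)) = comp u' (l (mkV j A gA a))).
by rewrite -hP !comp_assoc uu'.
Qed.

End Generators.

End CompactObjects.

(** * Accessible extensions *)

Lemma accessible_generators (S : set_theory) (kappa U : S) (C : set_category S) :
  universe U -> regular_cardinal kappa ->
  accessible_category kappa U C ->
  exists Gen : C -> Prop,
    [/\ usmall U {A | Gen A}, forall A, Gen A -> ecompact kappa U A &
        forall A, exists (J : set_category S) (D : functor J C) (c : cocone D),
          [/\ small U J, filtered kappa J, forall j, Gen (D j),
              is_colimit c & apex c = A]].
Proof.
move=> Uu kr [_ _ [G [GU Gc Ggen]]]; exists (fun A => val A ∈ G); split=> //.
  apply: (size_inj (usmall_size Uu) (f := fun A : {A : C | val A ∈ G} =>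
    to_El (proj2_sig A))); last exact: El_usmall.
  by move=> A B [/El_inj]; apply: sig_val_inj.
move=> A /Gc[B [/El_inj -> cB]]; exact/(compactE U kr).
Qed.

Lemma accessible_cocomplete (S : set_theory) (kappa U : S) (C : set_category S) :
  universe U -> regular_cardinal kappa ->
  accessible_category kappa U C -> compact_graph_colimits kappa U C ->
  locally_presentable_category kappa U C.
Proof.
move=> Uu kr aC K; split=> // J D sJ.
have [Gen [sG cG gG]] := accessible_generators Uu kr aC.
have [[obU _ hU] fC _] := aC.
apply: (small_colimits_of_compact Uu kr fC sG _ cG gG K) => // A B.
by apply: El_usmall.
Qed.

Definition map_graph (C E : category) (F : functor C E) (G : graph_diagram C) :
    graph_diagram E :=
  @GraphDiagram E (vtx G) (edge G) (@src C G) (@tgt C G) (fun v => F (vobj v))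
    (fun e => fmor F (emor e)).

Lemma map_graph_cocone (C E : category) (F : functor C E) (G : graph_diagram C)
    (Y : C) (l : forall v : vtx G, hom (vobj v) Y) :
  graph_cocone l -> @graph_cocone E (map_graph F G) (F Y) (fun v => fmor F (l v)).
Proof. by move=> lc e; rewrite /= -fmor_comp lc. Qed.

(** * Extensions, with the hypotheses phrased through [ecompact] *)

Section Extension.
Variables (S : set_theory) (kappa U V : S).
Hypotheses (kappa_regular : regular_cardinal kappa) (UV : subset U V).
Variables (C E : category) (i : functor C E).
Hypothesis i_filtered : preserves_filtered_colimits kappa U i.
Hypothesis i_compact : forall A, ecompact kappa U A -> ecompact kappa V (i A).
Hypothesis i_ff : forall A B, ecompact kappa U A -> ecompact kappa U B ->
  bijective (@fmor _ _ i A B).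
Hypothesis i_es : forall X, ecompact kappa V X ->
  exists A, ecompact kappa U A /\ isomorphic (i A) X.
Hypothesis C_generated : forall A : C, exists (J : set_category S)
  (D : functor J C) (c : cocone D), [/\ small U J, filtered kappa J,
    forall j, ecompact kappa U (D j), is_colimit c & apex c = A].
Hypothesis E_generated : forall A : E, exists (J : set_category S)
  (D : functor J E) (c : cocone D), [/\ small V J, filtered kappa J,
    forall j, ecompact kappa V (D j), is_colimit c & apex c = A].

Let ks := ksmall_size kappa_regular.

Lemma small_mono (J : set_category S) : small U J -> small V J.
Proof. by move=> [/UV obV /UV morV]. Qed.

Lemma ff_from_compact (A B : C) : ecompact kappa U A -> bijective (@fmor _ _ i A B).
Proof.
have [J [D [c [sJ fJ cD c_colim eB]]]] := C_generated B; subst B => cA.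
have ic_colim := i_filtered sJ fJ c_colim.
have [ci_fac ci_eq] := i_compact cA (small_mono sJ) fJ ic_colim.
have [c_fac _] := cA J D c sJ fJ c_colim.
apply: inj_surj_bij => [f g fg|h].
  (* [f] and [g] are lifted to a common stage, where the images of the lifts under [i] need not
     agree; they do at a later stage, and there [i] is faithful on compact objects. *)
  have [I|k [l lP]] := compact_family_factor kappa_regular
    sJ fJ c_colim (fun b : bool => if b then f else g) (size_bool ks).
    exact: cA.
  have [k' [u uP]] : exists k' (u : hom k k'),
      comp (fmor (comp_functor i D) u) (fmor i (l true)) =
      comp (fmor (comp_functor i D) u) (fmor i (l false)).
    by apply: ci_eq; rewrite /= -!fmor_comp (lP true) (lP false).
  rewrite -(lP true) -(lP false) -(leg_nat c u) -!comp_assoc; congr comp.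
  by apply: (bij_inj (i_ff cA (cD k'))); rewrite !fmor_comp.
have [k [h' h'P]] := ci_fac h.
have [g _ gK] := i_ff cA (cD k).
by exists (comp (leg c k) (g h')); rewrite fmor_comp gK.
Qed.

Lemma extension_fully_faithful : fully_faithful i.
Proof.
move=> A B; have [J [D [c [sJ fJ cD c_colim eA]]]] := C_generated A; subst A.
have ic_colim := i_filtered sJ fJ c_colim.
have iD_inj j : injective (@fmor _ _ i (D j) B) := bij_inj (ff_from_compact B (cD j)).
apply: inj_surj_bij => [f g fg|h].
  apply: (colimit_unique c_colim) => j; apply: iD_inj.
  by rewrite !fmor_comp fg.
have [|m mP] := choice_fun (I := J) (T := fun j => hom (D j) B)
    (P := fun j m => fmor i m = comp h (fmor i (leg c j))).
  move=> j; have [g _ gK] := ff_from_compact B (cD j).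
  by exists (g (comp h (fmor i (leg c j)))).
have [j k u|f fP] := colimit_exists c_colim (m := m).
  by apply: iD_inj; rewrite fmor_comp !mP -comp_assoc -fmor_comp leg_nat.
exists f; apply: (colimit_unique ic_colim) => j /=.
by rewrite -fmor_comp fP mP.
Qed.

Let i_inj (A B : C) : injective (@fmor _ _ i A B).
Proof. exact: faithful_inj extension_fully_faithful _ _. Qed.

Let i_full (A B : C) (h : hom (i A) (i B)) : exists h', fmor i h' = h.
Proof. exact: full_lift extension_fully_faithful _ _ _. Qed.

(* Since the objects [i A] with [A] compact generate [E], limit cones in [E] can
   be tested on them, and there they are limit cones of [C]. *)
Lemma extension_preserves_limit (J : category) (B : functor J C) :
  preserves_limit i B.
Proof.
move=> c c_lim.
have test A (cA : ecompact kappa U A) (m : forall j, hom (i A) (i (B j))) :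
    (forall j k (u : hom j k), comp (fmor i (fmor B u)) (m j) = m k) ->
    exists! h : hom (i A) (i (vertex c)),
      forall j, comp (fmor i (proj c j)) h = m j.
  move=> mn; have [m' m'P] := choice_fun (fun j => i_full (m j)).
  have m'n j k (u : hom j k) : comp (fmor B u) (m' j) = m' k.
    by apply: i_inj; rewrite fmor_comp !m'P.
  have [h [hP h_uniq]] := c_lim (Cone m'n).
  exists (fmor i h); split=> [j|h' h'P].
    by rewrite -fmor_comp hP m'P.
  have [h1 h1P] := i_full h'; subst h'; congr fmor; apply: h_uniq => j.
  by apply: i_inj; rewrite fmor_comp h'P m'P.
case=> Y m mn.
have [I [D [d [sI fI cD d_colim eY]]]] := E_generated Y; subst Y.
(* Each [D k] is compact, hence isomorphic to some [i A]; the test moves along this isomorphism. *)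
have test' k (n : forall j, hom (D k) (i (B j))) :
    (forall j j' (u : hom j j'), comp (fmor i (fmor B u)) (n j) = n j') ->
    exists! h : hom (D k) (i (vertex c)),
      forall j, comp (fmor i (proj c j)) h = n j.
  move=> nn; have [A [cA [p [q [qp pq]]]]] := i_es (cD k).
  have [j j' u|h [hP h_uniq]] := test A cA (fun j => comp (n j) p).
    by rewrite comp_assoc nn.
  exists (comp h q); split=> [j|h' h'P].
    by rewrite comp_assoc hP -comp_assoc pq comp_idr.
  rewrite (h_uniq (comp h' p)) => [|j]; last by rewrite comp_assoc h'P.
  by rewrite -comp_assoc pq comp_idr.
have [k|h hP] := choice_fun (I := I) (T := fun k => hom (D k) (i (vertex c)))
  (P := fun k h => forall j, comp (fmor i (proj c j)) h = comp (m j) (leg d k)).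
  have [j j' u|h [hP _]] := test' k (fun j => comp (m j) (leg d k)).
    by rewrite comp_assoc (mn _ _ u).
  by exists h.
(* The uniqueness half of [test'] makes the arrows [h k] compatible, so they glue to an arrow out of
   the colimit. *)
have [k k' u|f fP] := colimit_exists d_colim (m := h).
  have [j j' v|h0 [_ h0_uniq]] := test' k (fun j => comp (m j) (leg d k)).
    by rewrite comp_assoc (mn _ _ v).
  rewrite -(h0_uniq (h k)) // -(h0_uniq (comp (h k') (fmor D u))) // => j.
  by rewrite comp_assoc hP -comp_assoc leg_nat.
have fm j : comp (fmor i (proj c j)) f = m j.
  by apply: (colimit_unique d_colim) => k; rewrite -comp_assoc fP hP.
exists f; split=> // f' f'm; apply: (colimit_unique d_colim) => k.
have [j j' v|h0 [_ h0_uniq]] := test' k (fun j => comp (m j) (leg d k)).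
  by rewrite comp_assoc (mn _ _ v).
rewrite -(h0_uniq (comp f (leg d k))) => [|j]; last by rewrite comp_assoc fm.
by apply: h0_uniq => j; rewrite comp_assoc; congr comp; apply: f'm.
Qed.

(** A cocone into an object of [E] factors through a compact stage, isomorphic to some [i B], where
    the universal property in [C] applies because [i] is fully faithful. *)
Lemma map_compact_graph_colimit (G : graph_diagram C) (Q : C)
    (l : forall v : vtx G, hom (vobj v) Q) :
  ksmall kappa (vtx G) -> ksmall kappa (edge G) ->
  (forall v : vtx G, ecompact kappa U (vobj v)) -> graph_colimit l ->
  @graph_colimit E (map_graph i G) (i Q) (fun v => fmor i (l v)).
Proof.
move=> sV sE cV l_colim; have [lc l_ex l_uniq] := l_colim.
have cQ := i_compact (graph_colimit_compact kappa_regular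
  sV sE cV l_colim).
have icV (v : vtx (map_graph i G)) : ecompact kappa V (vobj v) by apply: i_compact.
split=> [|X m mc|X a b ab]; first exact: map_graph_cocone.
  have [J [D [c [sJ fJ cD c_colim eX]]]] := E_generated X; subst X.
  have [k [g [gc gP]]] := compact_graph_factor (G := map_graph i G)
    kappa_regular sJ fJ c_colim sV sE icV mc.
  have [B [_ [r [s [_ rs]]]]] := i_es (cD k).
  have [h hP] := choice_fun (fun v => i_full (comp s (g v))).
  have [|u uP] := l_ex B h.
    by move=> e; apply: i_inj; rewrite fmor_comp !hP -comp_assoc (gc e).
  exists (comp (leg c k) (comp r (fmor i u))) => v.
  by rewrite -!comp_assoc -fmor_comp uP hP [comp r _]comp_assoc rs comp_idl gP.
have [J [D [c [sJ fJ cD c_colim eX]]]] := E_generated X; subst X.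
(* For uniqueness, [i Q] is compact: [a] and [b] factor through one stage, and their composites with
   the legs agree at a later one, again isomorphic to some [i B]. *)
have [_|k [g gP]] := compact_family_factor kappa_regular
  sJ fJ c_colim (fun d : bool => if d then a else b) (size_bool ks).
  exact: cQ.
have [v|k' [u uP]] := compact_family_equal kappa_regular
    sJ fJ c_colim (j := k) (f := fun v => comp (g true) (fmor i (l v)))
    (g := fun v => comp (g false) (fmor i (l v))) sV icV.
  by rewrite !comp_assoc (gP true) (gP false) ab.
have [B [_ [r [s [_ rs]]]]] := i_es (cD k').
have [al alP] := i_full (comp s (comp (fmor D u) (g true))).
have [be beP] := i_full (comp s (comp (fmor D u) (g false))).
have albe : al = be.
  apply: l_uniq => v; apply: i_inj.
  by rewrite !fmor_comp alP beP -!comp_assoc uP.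
rewrite -(gP true) -(gP false) -(leg_nat c u) -!comp_assoc; congr comp.
rewrite -[comp _ (g true)]comp_idl -[comp _ (g false)]comp_idl -rs -!comp_assoc.
by rewrite -alP -beP albe.
Qed.

(** Vertices lift to [C] up to isomorphism and edges by fullness; the colimit of the lifted graph is
    preserved by [i], and its legs are corrected by the isomorphisms [q]. *)
Lemma compact_graph_colimits_up :
  compact_graph_colimits kappa U C -> compact_graph_colimits kappa V E.
Proof.
move=> K G sV sE cV.
have [A AP] := choice_fun (fun v => i_es (cV v)).
have [p pP] := choice_fun (fun v => proj2 (AP v)).
have [q pq] := choice_fun pP.
have [f fP] := choice_fun (fun e : edge G =>
  i_full (comp (q (tgt e)) (comp (emor e) (p (src e))))).
pose H := @GraphDiagram C (vtx G) (edge G) (@src E G) (@tgt E G) A f.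
have cH (v : vtx H) : ecompact kappa U (vobj v) by case: (AP v).
have [Q [l l_colim]] := K H sV sE cH.
have [lc l_ex l_uniq] := map_compact_graph_colimit (G := H) sV sE cH l_colim.
exists (i Q), (fun v => comp (fmor i (l v)) (q v)); split=> [e|Y m mc|Y u u' uu'].
- have := lc e; rewrite /= fP => <-.
  by rewrite -!comp_assoc (proj2 (pq _)) comp_idr.
- have [e|u uP] := l_ex Y (fun v => comp (m v) (p v)).
    rewrite /= fP comp_assoc -[comp (comp (m _) _) _]comp_assoc (proj2 (pq _)).
    by rewrite comp_idr comp_assoc mc.
  by exists u => v; rewrite comp_assoc uP -comp_assoc (proj2 (pq v)) comp_idr.
- apply: l_uniq => v; have := congr1 (fun h => comp h (p v)) (uu' v).
  by rewrite -!comp_assoc (proj1 (pq v)) comp_idr.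
Qed.

(** The colimit in [E] of the image graph is compact, so it is isomorphic to some [i A], and the
    fully faithful [i] reflects it. *)
Lemma compact_graph_colimits_down :
  compact_graph_colimits kappa V E -> compact_graph_colimits kappa U C.
Proof.
move=> K G sV sE cV.
have icV (v : vtx (map_graph i G)) : ecompact kappa V (vobj v) by apply: i_compact.
have [Q [l l_colim]] := K (map_graph i G) sV sE icV.
have cQ := graph_colimit_compact (G := map_graph i G) kappa_regular
  sV sE icV l_colim.
have [lc l_ex l_uniq] := l_colim.
have [A [_ [p [q [qp pq]]]]] := i_es cQ.
have [l' l'P] := choice_fun (fun v => i_full (comp q (l v))).
exists A, l'; split=> [e|Y m mc|Y u u' uu'].
- by apply: i_inj; rewrite fmor_comp !l'P -comp_assoc (lc e).
- have [u uP] := l_ex (i Y) _ (map_graph_cocone (F := i) mc).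
  have [w wP] := i_full (comp u p); exists w => v; apply: i_inj.
  by rewrite fmor_comp wP l'P -comp_assoc [comp p _]comp_assoc pq comp_idl uP.
apply: i_inj; rewrite -[LHS]comp_idr -[RHS]comp_idr -qp !comp_assoc; congr comp.
apply: l_uniq => v; rewrite -!comp_assoc -l'P -!fmor_comp; congr fmor.
exact: uu'.
Qed.

End Extension.

Theorem proposition3p6 (S : set_theory) (kappa U Uplus : S)
  (U_universe : universe U)
  (kappa_regular : regular_cardinal kappa)
  (kappa_in_U : elt kappa U)
  (Uplus_universe : universe Uplus)
  (U_sub_Uplus : subset U Uplus)
  (C Cplus : set_category S) (i : functor C Cplus)
  (i_extension : accessible_extension kappa U Uplus i) :
  (locally_presentable_category kappa U C <->
   locally_presentable_category kappa Uplus Cplus) /\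
  fully_faithful i /\
  (forall (J : set_category S) (B : functor J C), preserves_limit i B).
Proof.
case: i_extension => -[_ i_filt] aC aE [ic [iK_ff iK_es]].
have kUp := U_sub_Uplus _ kappa_in_U.
have CE A := compactE U kappa_regular (C := C) A.
have EE X := compactE Uplus kappa_regular (C := Cplus) X.
have ic' A : ecompact kappa U A -> ecompact kappa Uplus (i A).
  by move=> /CE/ic/EE.
have ff' A B : ecompact kappa U A -> ecompact kappa U B -> bijective (@fmor _ _ i A B).
  by move=> /CE cA /CE cB; exact: (iK_ff (exist _ A cA) (exist _ B cB)).
have es' X : ecompact kappa Uplus X ->
    exists A, ecompact kappa U A /\ isomorphic (i A) X.
  move=> /EE cX; have [[A cA] [f [g [gf fg]]]] := iK_es (exist _ X cX).
  by exists A; split; [apply/CE|exists f, g].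
have gC (A : C) : exists (J : set_category S) (D : functor J C) (c : cocone D),
    [/\ small U J, filtered kappa J, forall j, ecompact kappa U (D j),
        is_colimit c & apex c = A].
  have [Gen [_ cG gG]] := accessible_generators U_universe kappa_regular aC.
  have [J [D [c [sJ fJ gD c_colim eA]]]] := gG A.
  by exists J, D, c; split=> // j; apply: cG.
have gE (A : Cplus) : exists (J : set_category S) (D : functor J Cplus) (c : cocone D),
    [/\ small Uplus J, filtered kappa J, forall j, ecompact kappa Uplus (D j),
        is_colimit c & apex c = A].
  have [Gen [_ cG gG]] := accessible_generators Uplus_universe kappa_regular aE.
  have [J [D [c [sJ fJ gD c_colim eA]]]] := gG A.
  by exists J, D, c; split=> // j; apply: cG.
split; last split.
- split=> [[_ cC]|[_ cE]].
    (* Since [kappa] belongs to [U], graphs of size less than [kappa] are small and have colimits in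
       [C]; this restricted cocompleteness is carried up to [Cplus]. The converse is symmetric. *)
    apply: accessible_cocomplete => //.
    apply: (compact_graph_colimits_up kappa_regular
      U_sub_Uplus i_filt ic' ff' es' gC gE) => G sV sE _.
    apply: (small_has_graph_colimit U_universe cC).
      exact: ksmall_usmall sV.
    exact: ksmall_usmall sE.
  apply: accessible_cocomplete => //.
  apply: (compact_graph_colimits_down kappa_regular
    U_sub_Uplus i_filt ic' ff' es' gC) => G sV sE _.
  apply: (small_has_graph_colimit Uplus_universe cE).
    exact: ksmall_usmall sV.
  exact: ksmall_usmall sE.
- exact: (extension_fully_faithful kappa_regular
    U_sub_Uplus i_filt ic' ff' gC).
- move=> J B; exact: (extension_preserves_limit kappa_regular
    U_sub_Uplus i_filt ic' ff' es' gC gE).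
Qed.
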